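(* Let $\pi\in\mathcal M_+^1(\Theta)$ be a prior distribution such that $\operatorname{ess\,inf}_\pi R<\operatorname{ess\,sup}_\pi R$, let $\epsilon\in(0,1)$, let $\nu\in\mathcal M_+^1(\mathbb R_+)$ be an atomic probability distribution, and let $B(\rho,\beta,\gamma)$ be the empirical bound defined in the context. Let $$\widehat\beta(\rho)=\sup\Bigl\{\beta\in\mathbb R\;;\;\inf_{\gamma:\,N\tanh(\frac\gamma N)>\beta}B(\rho,\beta,\gamma)\le0\Bigr\}.$$ Then with $\mathbb P$ probability at least $1-\epsilon$, for any posterior distribution $\rho:\Omega\to\mathcal M_+^1(\Theta)$, $T(\rho)\le\widehat\beta(\rho)^{-1}$, or equivalently $$\rho(R)\le\pi_{\exp[-\widehat\beta(\rho)R]}(R).$$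
   Context: Setting. $N\ge 1$ is an integer, $(\mathcal X,\mathcal B)$ a measurable space, $\mathcal Y$ a finite set with the algebra of all its subsets, $\Omega=(\mathcal X\times\mathcal Y)^N$ with coordinate process $(X_i,Y_i)_{i=1}^N$, and $\mathbb P=\bigotimes_{i=1}^N P_i$ a product of arbitrary (not necessarily identical) probability measures on $\mathcal X\times\mathcal Y$. $(\Theta,\mathcal T)$ is a measurable space and $(\theta,x)\mapsto f_\theta(x)\in\mathcal Y$ is measurable on $\Theta\times\mathcal X$. All $\sigma$-algebras are countably generated. Put $$r(\theta)=\frac1N\sum_{i=1}^N\mathbf 1[f_\theta(X_i)\ne Y_i],\qquad R(\theta)=\frac1N\sum_{i=1}^N\mathbb P[f_\theta(X_i)\ne Y_i],$$ $$m'(\theta,\theta')=\frac1N\sum_{i=1}^N\bigl|\mathbf 1[f_\theta(X_i)\ne Y_i]-\mathbf 1[f_{\theta'}(X_i)\ne Y_i]\bigr|.$$ $\mathcal M_+^1(E)$ is the set of probability measures on $E$; $\mu(h)=\int h\,d\mu$; for a probability measure $\rho$ on $\Theta$, $\rho(m')$ denotes the function $\theta'\mapsto\int m'(\theta,\theta')\rho(d\theta)$. A posterior distribution is a regular conditional probability measure $\rho:\Omega\to\mathcal M_+^1(\Theta)$ (it may depend on the sample); a prior does not depend on the sample. $\mathcal K(\rho,\pi)=\int\log(d\rho/d\pi)\,d\rho$ if $\rho\ll\pi$, $+\infty$ otherwise. For bounded measurable $h$, $d\pi_{\exp(h)}/d\pi=\exp(h)/\pi[\exp(h)]$. The map $\beta\mapsto\pi_{\exp(-\beta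 R)}(R)$ is extended by continuity to $\beta\in\mathbb R\cup\{-\infty,+\infty\}$; it is continuous and strictly decreasing from $\operatorname{ess\,sup}_\pi R$ to $\operatorname{ess\,inf}_\pi R$. The effective temperature $T(\rho)\in\mathbb R\cup\{-\infty,+\infty\}$ of a posterior distribution $\rho$ is defined by $\rho(R)=\pi_{\exp(-R/T(\rho))}(R)$. Empirical bound. For real $\alpha$ and $\gamma>0$, $F_{\gamma,\alpha}(x)=-N\log[1-\tanh(\tfrac\gamma N)x]-\alpha x$; when $\alpha<N\tanh(\gamma/N)$ and $y\ge0$, $F_{\gamma,\alpha}^{-1}(y)$ is the unique $x\in[0,\tanh(\gamma/N)^{-1})$ with $F_{\gamma,\alpha}(x)=y$. Writing $\nu(\beta)$ for $\nu(\{\beta\})$, for $\beta,\gamma>0$, $$\begin{aligned}B(\rho,\beta,\gamma)=\inf\Bigl\{&\mathcal K\bigl[\rho,\pi_{\exp(-\lambda_1 r)}\bigr]+(\gamma-\lambda_1)\bigl[\rho(r)-\pi_{\exp(-\lambda_2 r)}(r)\bigr]\\&+\log\Bigl\{\pi_{\exp(-\lambda_1 r)}\Bigl[\exp\bigl\{N\log[\cosh(\tfrac{\gamma}{N})]\,\rho(m')\bigr\}\Bigr]\Bigr\}-\log\bigl[\epsilon\,\nu(\beta)\nu(\gamma)\bigr]\\&+(\gamma-\lambda_1)\tfrac{\beta}{\lambda_2}F^{-1}_{\gamma,\frac{\beta\gamma}{\lambda_2}}\Bigl[\log\Bigl\{\pi_{\exp(-\lambda_2 r)}\Bigl[\exp\bigl\{N\log[\cosh(\tfrac{\gamma}{N})]\,\pi_{\exp(-\lambda_2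 r)}(m')\bigr\}\Bigr]\Bigr\}-\log\bigl[\epsilon\,\nu(\beta)\nu(\gamma)\bigr]\Bigr]\Bigr\},\end{aligned}$$ the infimum being over $\lambda_1\in\mathbb R_+$, $\lambda_1\le\gamma$ and $\lambda_2>\frac{\beta\gamma}{N}\tanh(\frac\gamma N)^{-1}$. $B(\rho,\beta,\gamma)=+\infty$ when $\nu(\beta)=0$ or $\nu(\gamma)=0$ (in particular outside $\beta,\gamma>0$). ''With probability at least $1-\epsilon$, for any $\rho$'' means that on an event of probability at least $1-\epsilon$ the inequality holds simultaneously for all $\rho$.
   Formalization: If the set defining β̂(ρ) is empty (β̂ = −∞), T(ρ) ≤ β̂⁻¹ is stated only as β̂ ≤ 1/T(ρ), and ρ(R) ≤ π_{exp(−β̂R)}(R) is claimed only if T(ρ) exists: it fails e.g. for a Dirac ρ off the support of π with R above ess sup_π R. *)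

(* Defs.v *)
From HB Require Import structures.
From mathcomp Require Import all_boot all_order all_algebra.
From mathcomp Require Import all_classical all_reals all_analysis.
From mathcomp Require Import measurable_realfun ess_sup_inf.

Set Implicit Arguments.
Unset Strict Implicit.
Unset Printing Implicit Defensive.
Import Order.TTheory GRing.Theory Num.Theory.
Import numFieldNormedType.Exports.

Local Open Scope classical_set_scope.
Local Open Scope ring_scope.
Local Open Scope charge_scope.

Definition countably_generated d (T : measurableType d) : Prop :=
  exists2 G : set (set T), countable G & @measurable d T = <<s G >>.

(* The product measure is characterized, uniquely, by its values on the
   measurable rectangles, which generate the sigma-algebra of n.-tuple T. *)
Definition is_product_probability d (T : measurableType d) (R : realType)
    (n : nat) (P_ : 'I_n -> probability T R) (P : probability (n.-tuple T) R) :
    Prop :=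
  forall A : 'I_n -> set T, (forall i, measurable (A i)) ->
    P [set w | forall i, A i (tnth w i)] = (\prod_(i < n) fine (P_ i (A i)))%:E.

Definition atomic d (T : measurableType d) (R : realType)
    (nu : probability T R) : Prop :=
  exists2 D : set T, countable D & nu D = 1%E.

Section kernel_at.
Context dX dY (X : measurableType dX) (Y : measurableType dY) (R : realType).
Variables (k : R.-pker X ~> Y) (x : X).

(* k x, which the library only sees as a measure, as a probability *)
Definition kernel_at : set Y -> \bar R := k x.

HB.instance Definition _ := Measure.on kernel_at.

Let kernel_at_setT : kernel_at [set: Y] = 1%E.
Proof. exact: prob_kernel. Qed.

HB.instance Definition _ :=
  @Measure_isProbability.Build _ _ R kernel_at kernel_at_setT.

End kernel_at.

Section hyperbolic.
Context {R : realType}.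
Implicit Types x : R.

Definition cosh x : R := (expR x + expR (- x)) / 2.
Definition sinh x : R := (expR x - expR (- x)) / 2.
Definition tanh x : R := sinh x / cosh x.

End hyperbolic.

Section gibbs.
Context d (T : measurableType d) (R : realType).
Variables (mu : probability T R) (h : T -> R).

Definition bounded_measurable : Prop :=
  measurable_fun [set: T] h /\ exists M : R, forall t, `|h t| <= M.

Definition gibbs_density (t : T) : R := expR (h t) / \int[mu]_s expR (h s).

(* The measure mu_exp(h); it only makes sense for bounded measurable h and is
   given the junk value mu otherwise, so as to be a probability in all cases. *)
Definition gibbs : set T -> \bar R :=
  if `[< bounded_measurable >]
  then fun A => (\int[mu]_(t in A) (gibbs_density t)%:E)%E else mu.

Let gibbs_integrable : bounded_measurable ->
  mu.-integrable [set: T] (fun t => (expR (h t))%:E).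
Proof.
move=> [mh [M hM]].
apply: (@le_integrable _ _ _ mu _ measurableT _ (cst (expR M)%:E)) => //=.
- by apply/measurable_EFinP; exact: measurableT_comp.
- move=> t _; rewrite lee_fin !ger0_norm ?expR_ge0// ler_expR.
  exact: le_trans (ler_norm _) (hM t).
- exact/finite_measure_integrable_cst.
Qed.

Let gibbs_int_gt0 : bounded_measurable -> 0 < \int[mu]_s expR (h s).
Proof.
move=> bh; have ih := gibbs_integrable bh; have [mh [M hM]] := bh.
rewrite /Rintegral; rewrite -lte_fin fineK; last exact: integrable_fin_num.
have : (\int[mu]_t (expR (- M))%:E <= \int[mu]_t (expR (h t))%:E)%E.
  apply: ge0_le_integral => //=.
  - by apply/measurable_EFinP; exact: measurableT_comp.
  - move=> t _; rewrite lee_fin ler_expR lerNl.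
    by apply: le_trans (hM t); rewrite -normrN ler_norm.
rewrite integral_cst//= probability_setT mule1; apply: lt_le_trans.
by rewrite lte_fin expR_gt0.
Qed.

Let density_ge0 t : 0 <= gibbs_density t.
Proof.
rewrite divr_ge0 ?expR_ge0//; apply: fine_ge0; apply: integral_ge0 => s _.
by rewrite lee_fin expR_ge0.
Qed.

Let density_integrable : bounded_measurable ->
  mu.-integrable [set: T] (fun t => (gibbs_density t)%:E).
Proof.
move=> bh; rewrite /gibbs_density; under eq_fun do rewrite EFinM.
exact/integrableZr/gibbs_integrable.
Qed.

Let gibbs0 : gibbs set0 = 0%E.
Proof. by rewrite /gibbs; case: ifP => _ //; rewrite integral_set0. Qed.

Let gibbs_ge0 A : (0 <= gibbs A)%E.
Proof.
rewrite /gibbs; case: ifP => _ //; apply: integral_ge0 => t _.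
by rewrite lee_fin density_ge0.
Qed.

Let gibbs_sigma_additive : semi_sigma_additive gibbs.
Proof.
move=> A mA tA mUA; rewrite /gibbs.
case: ifPn => [/asboolP bh|_]; last exact: measure_semi_sigma_additive.
rewrite integral_bigcup//=; last first.
  by apply: (integrableS _ _ (subsetT _)) => //; exact: density_integrable.
apply: is_cvg_ereal_nneg_natsum_cond => n _ _.
by apply: integral_ge0 => /= t _; rewrite lee_fin density_ge0.
Qed.

HB.instance Definition _ := isMeasure.Build _ _ _
  gibbs gibbs0 gibbs_ge0 gibbs_sigma_additive.

Let gibbs_setT : gibbs [set: T] = 1%E.
Proof.
rewrite /gibbs; case: ifPn => [/asboolP bh|_]; last exact: probability_setT.
rewrite /gibbs_density; under eq_integral do rewrite EFinM.
rewrite integralZr//; last exact: gibbs_integrable.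
have Z0 := gibbs_int_gt0 bh.
rewrite -[X in (X * _)%E]fineK; last first.
  by apply: integrable_fin_num => //; exact: gibbs_integrable.
by rewrite -EFinM divff// gt_eqF.
Qed.

HB.instance Definition _ :=
  @Measure_isProbability.Build _ _ R gibbs gibbs_setT.

End gibbs.

Definition KL d (T : measurableType d) (R : realType)
    (rho mu : probability T R) : \bar R :=
  if `[< rho `<< mu >]
  then (\int[rho]_t lne (('d (charge_of_finite_measure rho) '/d mu) t))%E
  else +oo%E.

Section classification.
Context dX dY dT (X : measurableType dX) (Y : measurableType dY)
  (Theta : measurableType dT) (R : realType) (N : nat).
Variable f : Theta -> X -> Y.
Local Notation Omega := (N.-tuple (X * Y)%type).

Definition err (w : Omega) (i : 'I_N) (t : Theta) : R :=
  (f t (tnth w i).1 != (tnth w i).2)%:R.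

Definition emp_risk (w : Omega) (t : Theta) : R :=
  N%:R^-1 * \sum_(i < N) err w i t.

Definition risk (P : probability Omega R) (t : Theta) : R :=
  N%:R^-1 *
  \sum_(i < N) fine (P [set w | f t (tnth w i).1 != (tnth w i).2]).

Definition emp_dist (w : Omega) (t t' : Theta) : R :=
  N%:R^-1 * \sum_(i < N) `|err w i t - err w i t'|.

End classification.

Section temperature.
Context d (T : measurableType d) (R : realType).
Variables (prior : probability T R) (risk : T -> R).

(* beta |-> pi_exp(- beta R)(R), extended by continuity to -oo and +oo *)
Definition gibbs_mean (beta : \bar R) : R :=
  let g (b : R) := \int[gibbs prior (fun t => - b * risk t)]_t risk t in
  match beta with
  | b%:E => g b
  | +oo%E => lim (g b @[b --> +oo])
  | -oo%E => lim (g b @[b --> -oo])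
  end.

(* b = 1 / t, where 1 / 0 may be taken to be +oo (t = 0+) or -oo (t = 0-), and
   where both infinite temperatures have inverse 0; in particular this is not
   [inve], for which (-oo)^-1 = -oo. *)
Definition inverse_temperature (t b : \bar R) : Prop :=
  match t with
  | r%:E => if r == 0 then b = +oo%E \/ b = -oo%E else b = (r^-1)%:E
  | _ => b = 0%E
  end.

(* t is a value of T(rho), and b the corresponding value of 1 / T(rho) *)
Definition effective_temperature (rho : probability T R) (t b : \bar R) :
    Prop :=
  inverse_temperature t b /\ \int[rho]_s risk s = gibbs_mean b.

End temperature.

Section bound.
Context (R : realType) (N : nat).
Implicit Types alpha beta gamma x y : R.

Definition F gamma alpha x : R :=
  - N%:R * ln (1 - tanh (gamma / N%:R) * x) - alpha * x.

Definition Finv gamma alpha y : R :=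
  xget 0 [set x | 0 <= x < (tanh (gamma / N%:R))^-1 /\ F gamma alpha x = y].

Context d (T : measurableType d).
Variables (prior : probability T R) (eps : R) (nu : probability R R).
(* the empirical risk and the empirical distance of the observed sample *)
Variables (r : T -> R) (m : T -> T -> R).

Let gibbs_r (lambda : R) : probability T R :=
  gibbs prior (fun t => - lambda * r t).

Let atom (b : R) : R := fine (nu [set b]).

Definition log_moment gamma (lambda : R) (rho : probability T R) : R :=
  ln (\int[gibbs_r lambda]_t'
        expR (N%:R * ln (cosh (gamma / N%:R)) * \int[rho]_t m t t')).

Definition bound_expr (rho : probability T R) beta gamma (l1 l2 : R) :
    \bar R :=
  (KL rho (gibbs_r l1) +
   ((gamma - l1) * (\int[rho]_t r t - \int[gibbs_r l2]_t r t)
    + log_moment gamma l1 rho - ln (eps * atom beta * atom gamma)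
    + (gamma - l1) * (beta / l2) *
      Finv gamma (beta * gamma / l2)
        (log_moment gamma l2 (gibbs_r l2)
         - ln (eps * atom beta * atom gamma)))%R%:E)%E.

Definition bound (rho : probability T R) beta gamma : \bar R :=
  if [&& 0 < beta, 0 < gamma, 0 < atom beta & 0 < atom gamma]
  then ereal_inf [set z | exists l1 l2 : R,
    [/\ 0 <= l1 <= gamma,
        beta * gamma / N%:R * (tanh (gamma / N%:R))^-1 < l2
      & z = bound_expr rho beta gamma l1 l2]]
  else +oo%E.

Definition inf_bound (rho : probability T R) beta : \bar R :=
  ereal_inf [set bound rho beta gamma |
    gamma in [set gamma | beta < N%:R * tanh (gamma / N%:R)]].

(* -oo when the set is empty *)
Definition beta_hat (rho : probability T R) : \bar R :=
  ereal_sup [set beta%:E |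
    beta in [set beta : R | (inf_bound rho beta <= 0)%E]].

End bound.

(* Main.v *)
Require Import Defs.
From mathcomp Require Import all_boot all_order all_algebra.
From mathcomp Require Import all_classical all_reals all_analysis.
From mathcomp Require Import measurable_realfun ess_sup_inf.
From mathcomp Require Import ring lra.
Import Order.TTheory GRing.Theory Num.Theory.
Import numFieldNormedType.Exports.
Local Open Scope classical_set_scope.
Local Open Scope ring_scope.
Set Implicit Arguments.
Unset Strict Implicit.
Unset Printing Implicit Defensive.

(** The risk [R] is only known through the sample, and so is the measure
    [pibar = gibbs prior (- beta * R)]. Put [tau = tanh (gamma / N)] and
    [G x = - N * ln (1 - tau * x)], and for two parameters consider the
    discrepancy [G (R t - R t') - gamma * (r t - r t') - N * ln (cosh (gamma / N)) *
    m' t t']. Its exponential is a product over the observations, divided by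
    [(1 - tau * (R t - R t')) ^+ N], and the inequality between arithmetic and
    geometric means shows that its expectation is at most [1]
    ([mean_expR_discrepancy]). Since [pibar] does not depend on the sample, the
    double integral of this exponential against [pibar] in both variables also
    has expectation at most [1]; averaging over the atoms of [nu] and Markov's
    inequality yield an event of probability at least [1 - eps] on which these
    integrals are at most [1 / (eps * nu beta * nu gamma)] for all [beta] and
    [gamma] at once ([atomic_union_bound]).

    The rest is deterministic. The duality between relative entropy and
    exponential moments ([donsker_varadhan]) replaces [pibar] by an arbitrary
    [rho], at the price of [KL rho (gibbs prior (- l1 * r))]; convexity of [G]
    brings the means inside, and the terms that involve the unknown measure
    cancel, except for the mean of [r] under [pibar] ([pac_bayes]). That mean is
    compared with the mean of [r] under [gibbs prior (- l2 * r)] by applying the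
    same inequality to the latter measure ([gibbs_gap]). Altogether
    [F (rho R - pibar R)] is at most every expression in the definition of the
    bound ([le_bound_expr]). If [rho R > pibar R], then [F (rho R - pibar R)] is
    bounded away from [0], uniformly in [gamma]; so a non-positive infimum of the
    bounds over [gamma] implies [rho R <= pibar R] ([inf_bound_le0]).

    This holds for every [beta] in the set of which [beta_hat] is the supremum.
    The mean of [R] under [pibar] is strictly decreasing in [beta], because [R] is
    not almost surely constant, and it is continuous from the left, so the
    inequality passes to the supremum ([le_gibbs_mean_sup]); strict monotonicity
    turns it into the comparison of inverse temperatures. *)

(** * Means of bounded measurable functions *)

Section bounded_measurable.
Context d (T : measurableType d) (R : realType).
Implicit Types (f g : T -> R) (mu : probability T R).

Lemma bm_cst (c : R) : bounded_measurable (fun _ : T => c).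
Proof. by split; [exact: measurable_cst|exists `|c|]. Qed.

Lemma bmD f g : bounded_measurable f -> bounded_measurable g ->
  bounded_measurable (fun t => f t + g t).
Proof.
move=> [mf [M hM]] [mg [M' hM']]; split; first exact: measurable_funD.
exists (M + M') => t; rewrite (le_trans (ler_normD _ _))//; exact: lerD.
Qed.

Lemma bmM f g : bounded_measurable f -> bounded_measurable g ->
  bounded_measurable (fun t => f t * g t).
Proof.
move=> [mf [M hM]] [mg [M' hM']]; split; first exact: measurable_funM.
by exists (M * M') => t; rewrite normrM ler_pM.
Qed.

Lemma bmZ (c : R) f : bounded_measurable f ->
  bounded_measurable (fun t => c * f t).
Proof. exact/bmM/bm_cst. Qed.

Lemma bmN f : bounded_measurable f -> bounded_measurable (fun t => - f t).
Proof. by move=> /(bmZ (-1)); under eq_fun do rewrite mulN1r. Qed.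

Lemma bmB f g : bounded_measurable f -> bounded_measurable g ->
  bounded_measurable (fun t => f t - g t).
Proof. by move=> bf /bmN; exact: bmD. Qed.

Lemma bm_expR f : bounded_measurable f ->
  bounded_measurable (fun t => expR (f t)).
Proof.
move=> [mf [M hM]]; split; first exact: measurableT_comp.
exists (expR M) => t; rewrite ger0_norm ?expR_ge0// ler_expR.
exact: le_trans (ler_norm _) (hM t).
Qed.

Lemma bm_ln f (c : R) : bounded_measurable f -> 0 < c ->
  (forall t, c <= f t) -> bounded_measurable (fun t => ln (f t)).
Proof.
move=> [mf [M hM]] c0 cf; split.
  by apply: measurableT_comp => //; exact: measurable_ln.
exists (`|ln c| + `|ln M|) => t.
have f0 : 0 < f t by exact: lt_le_trans (cf t).
have fM : f t <= M by exact: le_trans (ler_norm _) (hM t).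
have M0 : 0 < M by exact: lt_le_trans fM.
have lec : ln c <= ln (f t) by rewrite ler_ln ?posrE.
have leM : ln (f t) <= ln M by rewrite ler_ln ?posrE.
rewrite ler_norml; apply/andP; split.
  have := ler_norm (- ln c); have := normr_ge0 (ln M); rewrite normrN; lra.
have := ler_norm (ln M); have := normr_ge0 (ln c); lra.
Qed.

Lemma bm_sum (I : Type) (s : seq I) (f : I -> T -> R) :
  (forall i, bounded_measurable (f i)) ->
  bounded_measurable (fun t => \sum_(i <- s) f i t).
Proof.
move=> bf; elim: s => [|i s ih].
  by under eq_fun do rewrite big_nil; exact: bm_cst.
by under eq_fun do rewrite big_cons; exact: bmD.
Qed.

Lemma bm_prod (I : Type) (s : seq I) (f : I -> T -> R) :
  (forall i, bounded_measurable (f i)) ->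
  bounded_measurable (fun t => \prod_(i <- s) f i t).
Proof.
move=> bf; elim: s => [|i s ih].
  by under eq_fun do rewrite big_nil; exact: bm_cst.
by under eq_fun do rewrite big_cons; exact: bmM.
Qed.

Lemma bm_integrable mu f : bounded_measurable f ->
  mu.-integrable [set: T] (EFin \o f).
Proof.
move=> [mf [M hM]].
apply: (@le_integrable _ _ _ mu _ measurableT _ (cst M%:E)) => //=.
- exact/measurable_EFinP.
- move=> t _; rewrite lee_fin (le_trans (hM t))//; exact: ler_norm.
- exact/finite_measure_integrable_cst.
Qed.

Lemma mean_EFin mu f : bounded_measurable f ->
  (\int[mu]_t (f t)%:E)%E = (\int[mu]_t f t)%:E.
Proof.
by move=> bf; rewrite /Rintegral fineK//; apply: integrable_fin_num => //;
  exact: bm_integrable.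
Qed.

Lemma mean_cst mu (c : R) : \int[mu]_t c = c.
Proof. by rewrite Rintegral_cst//= [X in fine X]probability_setT mulr1. Qed.

Lemma meanD mu f g : bounded_measurable f -> bounded_measurable g ->
  \int[mu]_t (f t + g t) = \int[mu]_t f t + \int[mu]_t g t.
Proof. by move=> bf bg; apply: RintegralD => //; exact: bm_integrable. Qed.

Lemma meanB mu f g : bounded_measurable f -> bounded_measurable g ->
  \int[mu]_t (f t - g t) = \int[mu]_t f t - \int[mu]_t g t.
Proof. by move=> bf bg; apply: RintegralB => //; exact: bm_integrable. Qed.

Lemma meanBc mu f (c : R) : bounded_measurable f ->
  \int[mu]_t (f t - c) = \int[mu]_t f t - c.
Proof. by move=> bf; rewrite meanB ?mean_cst//; exact: bm_cst. Qed.

Lemma mean_cB mu f (c : R) : bounded_measurable f ->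
  \int[mu]_t (c - f t) = c - \int[mu]_t f t.
Proof. by move=> bf; rewrite meanB ?mean_cst//; exact: bm_cst. Qed.

Lemma meanZ mu (c : R) f : bounded_measurable f ->
  \int[mu]_t (c * f t) = c * \int[mu]_t f t.
Proof. by move=> bf; apply: RintegralZl => //; exact: bm_integrable. Qed.

Lemma mean_sum (I : Type) (s : seq I) mu (f : I -> T -> R) :
  (forall i, bounded_measurable (f i)) ->
  \int[mu]_t (\sum_(i <- s) f i t) = \sum_(i <- s) \int[mu]_t f i t.
Proof.
move=> bf; elim: s => [|i s ih].
  by under eq_Rintegral do rewrite big_nil; rewrite mean_cst big_nil.
under eq_Rintegral do rewrite big_cons.
by rewrite meanD ?ih ?big_cons//; exact: bm_sum.
Qed.

Lemma bm_indic (A : set T) : measurable A ->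
  bounded_measurable (fun t => \1_A t : R).
Proof.
move=> mA; split; first exact: measurable_indic.
by exists 1 => t; rewrite indicE; case: (_ \in _); rewrite ?normr1 ?normr0.
Qed.

Lemma mean_indic mu (A : set T) : measurable A ->
  \int[mu]_t \1_A t = fine (mu A).
Proof. by move=> mA; rewrite /Rintegral integral_indic// setIT. Qed.

Lemma le_mean mu f g : bounded_measurable f -> bounded_measurable g ->
  (forall t, f t <= g t) -> \int[mu]_t f t <= \int[mu]_t g t.
Proof.
by move=> bf bg fg; apply: le_Rintegral => //; exact: bm_integrable.
Qed.

Lemma mean_ge mu f (c : R) : bounded_measurable f -> (forall t, c <= f t) ->
  c <= \int[mu]_t f t.
Proof.
move=> bf cf; rewrite -[leLHS](mean_cst mu); apply: le_mean => //.
exact: bm_cst.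
Qed.

Lemma mean_le mu f (c : R) : bounded_measurable f -> (forall t, f t <= c) ->
  \int[mu]_t f t <= c.
Proof.
move=> bf cf; rewrite -[leRHS](mean_cst mu); apply: le_mean => //.
exact: bm_cst.
Qed.

Lemma mean_eq0 mu f : bounded_measurable f -> (forall t, 0 <= f t) ->
  \int[mu]_t f t = 0 -> \forall t \ae mu, f t = 0.
Proof.
move=> bf f0 if0.
have := ae_eq_integral_abs mu measurableT
  (measurable_int mu (bm_integrable mu bf)).
case=> + _; have -> : (\int[mu]_t `|(EFin \o f) t|)%E = 0%E.
  under eq_integral do rewrite /= ger0_norm//.
  by rewrite mean_EFin// if0.
by move=> /(_ erefl); apply: filterS => t /(_ I)[].
Qed.

End bounded_measurable.

Lemma bm_comp d1 d2 (T1 : measurableType d1) (T2 : measurableType d2)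
    (R : realType) (f : T2 -> R) (g : T1 -> T2) : bounded_measurable f ->
  measurable_fun [set: T1] g -> bounded_measurable (fun t => f (g t)).
Proof.
move=> [mf [M hM]] mg; split; first exact: measurableT_comp.
by exists M.
Qed.

Section bounded_measurable_prod.
Context d1 d2 (T1 : measurableType d1) (T2 : measurableType d2) (R : realType).

Variables (f : T1 * T2 -> R) (bf : bounded_measurable f).

Lemma bm_section1 x : bounded_measurable (fun y => f (x, y)).
Proof. exact: (bm_comp (g := pair x) bf (pair1_measurable x)). Qed.

Lemma bm_section2 y : bounded_measurable (fun x => f (x, y)).
Proof. exact: (bm_comp (g := pair^~ y) bf (pair2_measurable y)). Qed.

(* Tonelli's measurability theorem is for non-negative functions: [f] is
   translated by one of its bounds. *)
Lemma bm_mean1 (m2 : probability T2 R) :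
  bounded_measurable (fun x => \int[m2]_y f (x, y)).
Proof.
have [mf [M hM]] := bf; split; last first.
  exists M => x; rewrite (le_trans (le_normr_Rintegral _ _))//.
    exact/bm_integrable/bm_section1.
  apply: mean_le => //; split; last by exists M => y; rewrite normr_id.
  by apply: measurableT_comp => //; exact: (bm_section1 x).1.
have bfM : bounded_measurable (fun z => f z + M) by apply: bmD => //; exact: bm_cst.
have -> : (fun x => \int[m2]_y f (x, y)) =
    (fun x => \int[m2]_y (f (x, y) + M) - M).
  apply/funext => x; rewrite (meanD _ (bm_section1 x)) ?mean_cst ?addrK//.
  exact: bm_cst.
apply: measurable_funB => //.
have := @measurable_fun_fubini_tonelli_F _ _ _ _ _ m2 (fun z => (f z + M)%:E).
move=> h; rewrite /Rintegral; apply: measurableT_comp => //; apply: h.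
  by apply/measurable_EFinP; case: bfM.
by move=> z; rewrite lee_fin -lerBlDr sub0r; have /ler_normlP[] := hM z; rewrite lerNl.
Qed.

Lemma bm_mean2 (m1 : probability T1 R) :
  bounded_measurable (fun y => \int[m1]_x f (x, y)).
Proof.
have [mf [M hM]] := bf; split; last first.
  exists M => y; rewrite (le_trans (le_normr_Rintegral _ _))//.
    exact/bm_integrable/bm_section2.
  apply: mean_le => //; split; last by exists M => x; rewrite normr_id.
  by apply: measurableT_comp => //; exact: (bm_section2 y).1.
have bfM : bounded_measurable (fun z => f z + M) by apply: bmD => //; exact: bm_cst.
have -> : (fun y => \int[m1]_x f (x, y)) =
    (fun y => \int[m1]_x (f (x, y) + M) - M).
  apply/funext => y; rewrite (meanD _ (bm_section2 y)) ?mean_cst ?addrK//.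
  exact: bm_cst.
apply: measurable_funB => //.
have := @measurable_fun_fubini_tonelli_G _ _ _ _ _ m1 (fun z => (f z + M)%:E).
move=> h; rewrite /Rintegral; apply: measurableT_comp => //; apply: h.
  by apply/measurable_EFinP; case: bfM.
by move=> z; rewrite lee_fin -lerBlDr sub0r; have /ler_normlP[] := hM z; rewrite lerNl.
Qed.

Variables (m1 : probability T1 R) (m2 : probability T2 R).

Lemma mean_exchange :
  \int[m1]_x \int[m2]_y f (x, y) = \int[m2]_y \int[m1]_x f (x, y).
Proof.
apply: EFin_inj; rewrite -(mean_EFin _ (bm_mean1 m2)) -(mean_EFin _ (bm_mean2 m1)).
transitivity (\int[m1]_x \int[m2]_y (f (x, y))%:E)%E.
  by apply: eq_integral => x _; rewrite mean_EFin//; exact: bm_section1.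
transitivity (\int[m2]_y \int[m1]_x (f (x, y))%:E)%E.
  exact: (Fubini (bm_integrable (m1 \x m2)%E bf)).
by apply: eq_integral => y _; rewrite mean_EFin//; exact: bm_section2.
Qed.

End bounded_measurable_prod.

(** * Log-partition functions and relative entropy *)

Section log_partition.
Context d (T : measurableType d) (R : realType).
Implicit Types (mu rho : probability T R) (h u : T -> R).

(** The log-Laplace transform. It encodes the whole family of Gibbs measures:
    [u |-> logZ mu (h + u) - logZ mu h] is the log-Laplace transform of
    [gibbs mu h], see [logZ_gibbs]. *)
Definition logZ mu h : R := ln (\int[mu]_t expR (h t)).

Lemma mean_expR_gt0 mu h : bounded_measurable h -> 0 < \int[mu]_t expR (h t).
Proof.
move=> bh; have [mh [M hM]] := bh.
apply: (@lt_le_trans _ _ (expR (- M))); first exact: expR_gt0.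
apply: mean_ge; first exact: bm_expR.
by move=> t; rewrite ler_expR lerNl; apply: le_trans (hM t); rewrite -normrN ler_norm.
Qed.

Lemma expR_logZ mu h : bounded_measurable h ->
  expR (logZ mu h) = \int[mu]_t expR (h t).
Proof. by move=> bh; rewrite lnK// posrE mean_expR_gt0. Qed.

(** The exponential lies above its tangent at the mean [c] of [u]. *)
Lemma jensen_expR mu u : bounded_measurable u -> \int[mu]_t u t <= logZ mu u.
Proof.
move=> bu; set c := \int[mu]_t u t; rewrite -ler_expR expR_logZ//.
have bl : bounded_measurable (fun t => expR c * ((1 - c) + u t)).
  by apply/bmZ/bmD => //; exact: bm_cst.
have -> : expR c = \int[mu]_t (expR c * ((1 - c) + u t)).
  rewrite meanZ; last by apply/bmD => //; exact: bm_cst.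
  by rewrite meanD//; [rewrite mean_cst -/c subrK mulr1|exact: bm_cst].
apply: le_mean => //; first exact: bm_expR.
move=> t; rewrite -[in leRHS](subrKC c (u t)) [leRHS]expRD.
rewrite ler_pM2l ?expR_gt0//.
apply: le_trans (expR_ge1Dx _); lra.
Qed.

Lemma gibbsE mu h A : bounded_measurable h ->
  gibbs mu h A = (\int[mu]_(t in A) (gibbs_density mu h t)%:E)%E.
Proof. by move=> bh; rewrite /gibbs asboolT. Qed.

Lemma gibbs_dominates mu h : gibbs mu h `<< mu.
Proof.
apply/null_content_dominatesP => A mA muA0; rewrite /gibbs.
case: ifPn => [/asboolP bh|_ //].
apply: null_set_integral => //; apply/measurable_funTS/measurable_EFinP.
exact: (bmM (bm_expR bh) (bm_cst T (\int[mu]_s expR (h s))^-1)).1.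
Qed.

Lemma bm_gibbs_density mu h : bounded_measurable h ->
  bounded_measurable (gibbs_density mu h).
Proof. by move=> bh; apply: bmM; [exact: bm_expR|exact: bm_cst]. Qed.

Local Open Scope charge_scope.

Lemma gibbs_derivative mu h : bounded_measurable h ->
  ae_eq mu setT ('d (charge_of_finite_measure (gibbs mu h)) '/d mu)
    (EFin \o gibbs_density mu h).
Proof.
move=> bh; apply: integral_ae_eq => //.
- exact/Radon_Nikodym_integrable/gibbs_dominates.
- apply/measurable_EFinP; exact: (bm_gibbs_density mu bh).1.
- move=> A _ mA; rewrite -Radon_Nikodym_integral//; last exact: gibbs_dominates.
  exact: gibbsE.
Qed.

Lemma mean_gibbs mu h u : bounded_measurable h -> bounded_measurable u ->
  \int[gibbs mu h]_t u t =
  (\int[mu]_t (u t * expR (h t))) / \int[mu]_t expR (h t).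
Proof.
move=> bh bu; apply: EFin_inj; rewrite -mean_EFin//.
have iu := bm_integrable (gibbs mu h) bu.
have dom : gibbs mu h `<< mu by exact: gibbs_dominates.
rewrite -(Radon_Nikodym_change_of_variables dom _ iu)//.
have bue := bmM bu (bm_expR bh).
transitivity (\int[mu]_t (u t * gibbs_density mu h t)%:E)%E.
  apply: ae_eq_integral => //.
  - apply: emeasurable_funM; first exact: measurable_int iu.
    by apply: measurable_int; exact/Radon_Nikodym_integrable/gibbs_dominates.
  - apply/measurable_EFinP; exact: (bmM bu (bm_gibbs_density mu bh)).1.
  - have := gibbs_derivative mu bh; apply: filterS => t /(_ I) /= -> _ /=.
    by rewrite EFinM.
rewrite mean_EFin; last exact/bmM/bm_gibbs_density.
congr EFin; rewrite /gibbs_density.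
under eq_Rintegral do rewrite mulrA mulrC.
by rewrite meanZ// mulrC.
Qed.

Lemma logZ_gibbs mu h u : bounded_measurable h -> bounded_measurable u ->
  logZ (gibbs mu h) u = logZ mu (fun t => h t + u t) - logZ mu h.
Proof.
move=> bh bu; rewrite {1}/logZ mean_gibbs//; last exact: bm_expR.
under [in X in X / _]eq_Rintegral do rewrite mulrC -expRD.
rewrite ln_div// posrE; apply: mean_expR_gt0 => //; exact: bmD.
Qed.

(** The variational inequality for Gibbs measures: the difference of the two
    log-partition functions, minus the mean on the left, is the relative entropy
    of [gibbs mu h] with respect to [gibbs mu (h + u)]. *)
Lemma gibbs_jensen mu h u : bounded_measurable h -> bounded_measurable u ->
  \int[gibbs mu h]_t u t <= logZ mu (fun t => h t + u t) - logZ mu h.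
Proof. by move=> bh bu; rewrite -logZ_gibbs//; exact: jensen_expR. Qed.

End log_partition.

(** Monotonicity holds for the positive and the negative parts separately, hence
    without integrability; this is how a lower bound on a relative entropy is
    obtained whether or not it is finite. *)
Lemma le_measurable_integral d (T : measurableType d) (R : realType)
    (mu : {measure set T -> \bar R}) (f g : T -> \bar R) :
  measurable_fun [set: T] f -> measurable_fun [set: T] g ->
  (forall t, f t <= g t)%E -> (\int[mu]_t f t <= \int[mu]_t g t)%E.
Proof.
move=> mf mg fg; rewrite integralE [leRHS]integralE leeB//.
- apply: ge0_le_integral => //; [exact: measurable_funepos..|].
  by move=> x /mem_set; apply: funepos_le => y _; exact: fg.
- apply: ge0_le_integral => //; [exact: measurable_funeneg..|].
  by move=> x /mem_set; apply: funeneg_le => y _; exact: fg.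
Qed.

Section donsker_varadhan.
Context d (T : measurableType d) (R : realType).
Variables (mu rho : probability T R).
Local Open Scope charge_scope.

(** With [p] the density of [rho] and [w = expR (u - logZ mu u) / p], the mean of
    [w] under [rho] is at most [1], and [ln w <= w - 1]; the mean of [- ln w] is
    the difference of the two sides. *)
Theorem donsker_varadhan (u : T -> R) : bounded_measurable u ->
  ((\int[rho]_t u t - logZ mu u)%:E <= KL rho mu)%E.
Proof.
move=> bu; rewrite /KL; case: ifPn => [/asboolP rhomu|_]; last exact: leey.
pose g := Radon_Nikodym_SigmaFinite.f rho mu.
have g0 t : (0 <= g t)%E by exact: Radon_Nikodym_SigmaFinite.f_ge0.
have gfin t : g t \is a fin_num by exact: Radon_Nikodym_SigmaFinite.f_fin_num.
have mg : measurable_fun setT g.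
  by apply: measurable_int (Radon_Nikodym_SigmaFinite.f_integrable _).
(* The density vanishes on a [rho]-null set only; replacing it there by [1] makes
   it positive everywhere. *)
pose p t : R := if (0 < g t)%E then fine (g t) else 1.
have p0 t : 0 < p t.
  by rewrite /p; case: ifPn => // gt0; rewrite fine_gt0// gt0/= ltey_eq gfin.
have gp t : (g t <= (p t)%:E)%E.
  by rewrite /p; case: ifPn => [_|]; [rewrite fineK|rewrite -leNgt => /le_trans; apply; rewrite lee_fin].
have mp : measurable_fun setT p.
  apply: measurable_fun_ifT => //.
    exact: measurable_fun_lte.
  exact: measurableT_comp.
pose A := [set t | (g t <= 0)%E].
have mA : measurable A.
  by rewrite /A -[X in measurable X]setTI; exact: emeasurable_fun_infty_c.
have rhoA : rho A = 0%E.
  rewrite (Radon_Nikodym_SigmaFinite.f_integral rhomu mA).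
  by apply: integral0_eq => t At; apply/eqP; rewrite eq_le At g0.
have KLE : (\int[rho]_t lne (('d (charge_of_finite_measure rho) '/d mu) t) =
    \int[rho]_t (ln (p t))%:E)%E.
  apply: ae_eq_integral => //.
  - pose D := 'd (charge_of_finite_measure rho) '/d mu.
    have -> : (fun t => lne (D t)) = (fun t => if (D t <= 0)%E then -oo%E
        else (ln (fine (D t)))%:E).
      apply/funext => t; have : D t \is a fin_num.
        exact: (@Radon_Nikodym_fin_num _ _ _ (charge_of_finite_measure rho)).
      by case: (D t) => // r _; rewrite /= lee_fin.
    have mD : measurable_fun setT D.
      apply: (measurable_int mu).
      exact: (@Radon_Nikodym_integrable _ _ _ (charge_of_finite_measure rho)).
    apply: measurable_fun_ifT => //; first exact: measurable_fun_lee.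
    apply/measurable_EFinP; apply: measurableT_comp; first exact: measurable_ln.
    exact: measurableT_comp.
  - by apply/measurable_EFinP; apply: measurableT_comp => //; exact: measurable_ln.
  have /(null_dominates_ae_eq measurableT rhomu) :=
    ae_eq_Radon_Nikodym_SigmaFinite rhomu measurableT.
  have : {ae rho, forall t, ~ A t} by exists A; split => // t /= /contrapT.
  apply: filterS2 => t nA /(_ I) <- _.
  have gt0 : (0 < g t)%E by rewrite ltNge; apply/negP.
  rewrite -/(g t) /p gt0; move: (gfin t) gt0; case: (g t) => // r _ r0.
  by rewrite lne_EFin.
rewrite KLE; set L := logZ mu u.
pose w t := expR (u t - L - ln (p t)).
have w0 t : 0 <= w t by exact: expR_ge0.
have mu_ : measurable_fun setT u by exact: bu.1.
have mw : measurable_fun setT w.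
  apply: measurableT_comp => //; apply: measurable_funB.
    exact: measurable_funB.
  by apply: measurableT_comp => //; exact: measurable_ln.
have buL : bounded_measurable (fun t => u t - L) by apply: bmB => //; exact: bm_cst.
have w1 : (\int[rho]_t (w t)%:E <= 1)%E.
  rewrite -(Radon_Nikodym_SigmaFinite.change_of_variables rhomu)//; last first.
    exact/measurable_EFinP.
  have -> : 1%E = (\int[mu]_t (expR (u t - L))%:E)%E.
    rewrite mean_EFin; last exact: bm_expR.
    under eq_Rintegral do rewrite expRD mulrC.
    by rewrite meanZ ?expRN ?expR_logZ ?mulVf ?gt_eqF ?mean_expR_gt0//; exact: bm_expR.
  apply: ge0_le_integral => //.
  - by move=> t _; rewrite mule_ge0 ?lee_fin.
  - by apply: emeasurable_funM => //; exact/measurable_EFinP.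
  - by apply/measurable_EFinP; exact: (bm_expR buL).1.
  - move=> t _; apply: (@le_trans _ _ ((w t)%:E * (p t)%:E)%E).
      by rewrite lee_wpmul2l// lee_fin.
    by rewrite -EFinM /w expRB lnK ?posrE// divfK// gt_eqF.
have iw : rho.-integrable setT (EFin \o w).
  apply/integrableP; split; first exact/measurable_EFinP.
  under eq_integral do rewrite /= ger0_norm//.
  exact: le_lt_trans w1 (ltry _).
have wfin : (\int[rho]_t (w t)%:E)%E \is a fin_num.
  exact: integrable_fin_num.
apply: (@le_trans _ _ (\int[rho]_t ((u t - L + 1)%:E - (w t)%:E))%E).
  have buL1 : bounded_measurable (fun t => u t - L + 1).
    by apply: bmD => //; exact: bm_cst.
  rewrite integralB//; last exact: bm_integrable.
  rewrite mean_EFin// meanD//; last exact: bm_cst.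
  rewrite meanB//; last exact: bm_cst.
  by rewrite !mean_cst [in leRHS](EFinD (_ - _)) -addeA leeDl// sube_ge0 ?wfin ?orbT.
apply: le_measurable_integral.
- apply: emeasurable_funB; last exact/measurable_EFinP.
  by apply/measurable_EFinP/measurable_funD => //; exact: measurable_funB.
- by apply/measurable_EFinP; apply: measurableT_comp => //; exact: measurable_ln.
move=> t; rewrite -EFinB lee_fin.
have := expR_ge1Dx (u t - L - ln (p t)); rewrite -/(w t); lra.
Qed.

End donsker_varadhan.

(** * Hyperbolic functions and the inverse of F *)

Section hyperbolic_facts.
Context {R : realType}.
Implicit Types a : R.

Lemma cosh_gt0 a : 0 < cosh a.
Proof. by rewrite divr_gt0// addr_gt0// expR_gt0. Qed.

Lemma cosh_ge1 a : 1 <= cosh a.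
Proof.
rewrite /cosh; have := expR_gt0 a; have := expRxMexpNx_1 a.
set x := expR a; set y := expR (- a) => xy x0.
have y0 : 0 < y by exact: expR_gt0.
rewrite ler_pdivlMr//; have : 0 <= (x - y) ^+ 2 by exact: sqr_ge0.
nra.
Qed.

Lemma tanh_lt1 a : tanh a < 1.
Proof.
rewrite /tanh ltr_pdivrMr ?cosh_gt0// mul1r /sinh /cosh.
by rewrite ltr_pM2r ?invr_gt0//; have := expR_gt0 (- a); lra.
Qed.

Lemma tanh_gt0 a : 0 < a -> 0 < tanh a.
Proof.
move=> a0; rewrite divr_gt0 ?cosh_gt0// divr_gt0// subr_gt0 ltr_expR.
lra.
Qed.

Lemma coshN a : cosh (- a) = cosh a.
Proof. by rewrite /cosh opprK addrC. Qed.

Lemma tanhN a : tanh (- a) = - tanh a.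
Proof.
rewrite /tanh coshN; have -> : sinh (- a) = - sinh a by rewrite /sinh opprK; lra.
exact: mulNr.
Qed.

Lemma norm_tanh_lt1 a : `|tanh a| < 1.
Proof. by rewrite ltr_norml tanh_lt1 ltrNl -tanhN tanh_lt1. Qed.

Lemma expR_div_cosh a : expR a / cosh a = 1 + tanh a.
Proof.
have c0 := cosh_gt0 a; apply: (mulIf (lt0r_neq0 c0)).
rewrite divfK ?gt_eqF// mulrDl mul1r /tanh divfK ?gt_eqF//.
rewrite /cosh /sinh; lra.
Qed.

End hyperbolic_facts.

Section log_loss.
Context {R : realType} (N : nat) (hN : (0 < N)%N) (gamma : R).
Local Notation tau := (tanh (gamma / N%:R)).

Definition log_loss (x : R) : R := - N%:R * ln (1 - tau * x).

Lemma FE alpha x : F N gamma alpha x = log_loss x - alpha * x.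
Proof. by []. Qed.

Let N0 : 0 < N%:R :> R. Proof. by rewrite ltr0n. Qed.

(** [log_loss] is convex, because [ln] lies below its tangents. *)
Lemma log_loss_tangent (x u : R) : tau * x < 1 -> tau * u < 1 ->
  log_loss x + N%:R * tau / (1 - tau * x) * (u - x) <= log_loss u.
Proof.
move=> x1 u1; have x0 : 0 < 1 - tau * x by lra.
have u0 : 0 < 1 - tau * u by lra.
have : ln ((1 - tau * u) / (1 - tau * x)) <= (1 - tau * u) / (1 - tau * x) - 1.
  have := @le_ln1Dx _ ((1 - tau * u) / (1 - tau * x) - 1).
  by rewrite subrKC; apply; rewrite ltrBrDr addNr divr_gt0.
rewrite ln_div ?posrE// /log_loss => h.
have E : (1 - tau * u) / (1 - tau * x) - 1 =
    - (tau / (1 - tau * x) * (u - x)) by field; rewrite gt_eqF.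
rewrite {}E in h.
have -> : N%:R * tau / (1 - tau * x) * (u - x) =
  N%:R * (tau / (1 - tau * x) * (u - x)) by ring.
move: h; set k := tau / _ * _ => /(ler_wpM2l (ltW N0)); lra.
Qed.

Hypothesis gamma0 : 0 < gamma.
Let tau0 : 0 < tau. Proof. by rewrite tanh_gt0// divr_gt0. Qed.

(** By convexity the slopes on the non-negative axis are at least the derivative
    at [0], which is [N * tau]. *)
Lemma log_loss_slope (x u : R) : 0 <= x <= u -> tau * u < 1 ->
  log_loss x + N%:R * tau * (u - x) <= log_loss u.
Proof.
move=> /andP[x0 xu] u1.
have x1 : tau * x < 1 by apply: le_lt_trans u1; rewrite ler_pM2l.
apply: le_trans (log_loss_tangent x1 u1).
rewrite lerD2l ler_wpM2r ?subr_ge0// ler_pdivlMr; last by lra.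
have Nt0 : 0 <= N%:R * tau by rewrite mulr_ge0// ltW.
have tx0 : 0 <= tau * x by rewrite mulr_ge0// ltW.
by rewrite ler_piMr//; lra.
Qed.

Section inverse.
Variable alpha : R.

Lemma Finv_spec (y : R) : 0 <= y ->
  0 <= Finv N gamma alpha y < tau^-1 /\
  F N gamma alpha (Finv N gamma alpha y) = y.
Proof.
move=> y0.
suff [x hx] : exists x, 0 <= x < tau^-1 /\ F N gamma alpha x = y.
  by rewrite /Finv; exact: (@xgetPex _ 0 [set x | _] (ex_intro _ x hx)).
(* At [x1], [log_loss] is equal to [y + |alpha| / tau], and the linear part
   [alpha * x1] of [F] is at most [|alpha| / tau]. *)
pose k := (y + `|alpha| / tau) / N%:R.
have k0 : 0 <= k by rewrite divr_ge0// addr_ge0// divr_ge0// ltW.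
pose x1 := (1 - expR (- k)) / tau.
have tx1 : tau * x1 = 1 - expR (- k) by rewrite mulrC divfK// gt_eqF.
have x10 : 0 <= x1 by rewrite divr_ge0//; [rewrite subr_ge0 expR_le1; lra|exact: ltW].
have x1lt : x1 < tau^-1.
  rewrite -[ltRHS]mul1r ltr_pM2r ?invr_gt0//.
  by have := expR_gt0 (- k); lra.
have Fx1 : y <= F N gamma alpha x1.
  rewrite FE /log_loss tx1 subKr expRK mulrNN /k mulrC divfK ?gt_eqF//.
  have : alpha * x1 <= `|alpha| / tau.
    apply: le_trans (ler_norm _) _; rewrite normrM ler_wpM2l//.
    by rewrite ger0_norm// ltW.
  lra.
have F0 : F N gamma alpha 0 <= y.
  by rewrite FE /log_loss !mulr0 !subr0 ln1 mulr0.
have [||c] := @IVT _ (F N gamma alpha) 0 x1 y x10.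
- apply: continuous_in_subspaceT => x; rewrite inE/= in_itv/= => /andP[_ xx1].
  have tx : 0 < 1 - tau * x.
    rewrite subr_gt0 mulrC -ltr_pdivlMr// div1r; exact: le_lt_trans x1lt.
  apply: cvgB; last by apply: cvgM; [apply: cvg_cst|apply: cvg_id].
  apply: cvgM; first exact: cvg_cst.
  apply: continuous_cvg; first exact: continuous_ln.
  by apply: cvgB; [exact: cvg_cst|apply: cvgM; [apply: cvg_cst|apply: cvg_id]].
- by rewrite ge_min le_max F0 Fx1 orbT.
- rewrite in_itv/= => /andP[c0 cx1] Fc; exists c; split => //.
  by rewrite c0/= (le_lt_trans cx1).
Qed.

Hypothesis alpha_lt : alpha < N%:R * tau.

Lemma F_lt (x u : R) : 0 <= x < u -> u < tau^-1 ->
  F N gamma alpha x < F N gamma alpha u.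
Proof.
move=> /andP[x0 xu] u1; rewrite !FE.
have xu' : 0 <= x <= u by rewrite x0 ltW.
have : tau * u < 1 by rewrite mulrC -ltr_pdivlMr// div1r.
move=> /(log_loss_slope xu').
have : 0 < (N%:R * tau - alpha) * (u - x) by rewrite mulr_gt0 ?subr_gt0.
lra.
Qed.

Lemma le_Finv (x y : R) : 0 <= y -> x < tau^-1 -> F N gamma alpha x <= y ->
  x <= Finv N gamma alpha y.
Proof.
move=> y0 x1; have [/andP[v0 v1] vE] := Finv_spec y0.
move=> Fx; rewrite leNgt; apply/negP => vx.
have := @F_lt (Finv N gamma alpha y) x; rewrite v0 vx vE => /(_ isT x1).
by rewrite ltNge Fx.
Qed.

End inverse.

End log_loss.

(** * A deterministic PAC-Bayesian inequality *)

Lemma gibbs_gap_arith (R : realType) (b g l D x y Lp Gx Gy s : R) :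
  b * (x - y) <= s * (x - y) -> Gy + s * (x - y) <= Gx ->
  Gx - b * x <= (g - l) * D + Lp -> b * y = l * D -> Gy - g * D <= Lp.
Proof. lra. Qed.

Section pac_bayes.
Context d (T : measurableType d) (R : realType) (N : nat) (hN : (0 < N)%N).
Variables (prior : probability T R) (L r : T -> R) (m : T -> T -> R).
Hypotheses (bL : bounded_measurable L) (br : bounded_measurable r).
Hypothesis bm : bounded_measurable (fun z : T * T => m z.1 z.2).
Hypothesis L01 : forall t, 0 <= L t <= 1.
Hypothesis m0 : forall t t', 0 <= m t t'.
Variables (beta gamma : R).
Hypothesis gamma0 : 0 < gamma.

Local Notation tau := (tanh (gamma / N%:R)).
Local Notation lc := (N%:R * ln (cosh (gamma / N%:R))).
Local Notation G := (log_loss N gamma).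
Local Notation pibar := (gibbs prior (fun t => - beta * L t)).
Local Notation gibbs_r := (fun l => gibbs prior (fun t => - l * r t)).

(** The gap between the risks of [t] and [t'], measured by the convex function
    [G], in excess of what the sample accounts for. The coefficient of [m] is
    the one for which the exponential of the discrepancy is a product of affine
    functions of the individual errors, see [expR_discrepancy]. *)
Definition discrepancy (t t' : T) : R :=
  G (L t - L t') - gamma * (r t - r t') - lc * m t t'.

Variable c : R.
Hypothesis c0 : 0 < c.
Hypothesis exp_discrepancy :
  \int[pibar]_t \int[pibar]_t' expR (discrepancy t t') <= c^-1.

Let N0 : 0 < N%:R :> R. Proof. by rewrite ltr0n. Qed.

Let tau0 : 0 < tau. Proof. by rewrite tanh_gt0// divr_gt0. Qed.

Let bbL : bounded_measurable (fun t => - beta * L t). Proof. exact: bmZ. Qed.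

Let blr l : bounded_measurable (fun t => - l * r t). Proof. exact: bmZ. Qed.

Let tauL x : x <= 1 -> tau * x < 1.
Proof.
by move=> x1; apply: le_lt_trans (tanh_lt1 (gamma / N%:R)); rewrite ler_piMr// ltW.
Qed.

Let diffL t t' : L t - L t' <= 1.
Proof. by have := L01 t; have := L01 t'; lra. Qed.

Let diff_mean (mu mu' : probability T R) : \int[mu]_t L t - \int[mu']_t L t <= 1.
Proof.
have : \int[mu]_t L t <= 1 by apply: mean_le => // t; case/andP: (L01 t).
have : 0 <= \int[mu']_t L t by apply: mean_ge => // t; case/andP: (L01 t).
lra.
Qed.

Let b1 (g : T -> R) : bounded_measurable g ->
  bounded_measurable (fun z : T * T => g z.1).
Proof. by move=> bg; apply: (bm_comp bg); exact: measurable_fst. Qed.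

Let b2 (g : T -> R) : bounded_measurable g ->
  bounded_measurable (fun z : T * T => g z.2).
Proof. by move=> bg; apply: (bm_comp bg); exact: measurable_snd. Qed.

Lemma bm_discrepancy :
  bounded_measurable (fun z : T * T => discrepancy z.1 z.2).
Proof.
apply: bmB; last exact: bmZ.
apply: bmB; last by apply: bmZ; apply: bmB; [exact: b1|exact: b2].
apply: bmZ; apply: (@bm_ln _ _ _ _ (1 - tau)).
- apply: bmB; first exact: bm_cst.
  by apply: bmZ; apply: bmB; [exact: b1|exact: b2].
- by rewrite subr_gt0 tanh_lt1.
- by move=> z; rewrite lerD2l lerN2 ler_piMr// ltW.
Qed.

(** Linearizing the convex function [G] at the mean gap turns the discrepancy
    into a sum of terms which are affine in each of the two arguments. *)
Let mean_discrepancy (rho : probability T R) :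
  G (\int[rho]_t L t - \int[pibar]_t L t) - gamma * (\int[rho]_t r t - \int[pibar]_t r t)
    - lc * \int[rho]_t \int[pibar]_t' m t t'
  <= \int[rho]_t \int[pibar]_t' discrepancy t t'.
Proof.
set x := \int[rho]_t L t - _; have bd := bm_discrepancy.
pose s := N%:R * tau / (1 - tau * x).
have bm1 t : bounded_measurable (m t) := bm_section1 bm t.
have bmm : bounded_measurable (fun t => \int[pibar]_t' m t t') := bm_mean1 bm _.
pose k t := G x + s * (L t - \int[pibar]_t L t - x)
  - gamma * (r t - \int[pibar]_t r t) - lc * \int[pibar]_t' m t t'.
have bk : bounded_measurable k.
  apply: bmB; last exact: bmZ.
  apply: bmB; last by apply: bmZ; apply: bmB => //; exact: bm_cst.
  apply: bmD; first exact: bm_cst.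
  by apply: bmZ; do 2 (apply: bmB; last exact: bm_cst).
have intk : \int[rho]_t k t = G x - gamma * (\int[rho]_t r t - \int[pibar]_t r t)
    - lc * \int[rho]_t \int[pibar]_t' m t t'.
  have bLx : bounded_measurable (fun t => L t - \int[pibar]_t L t - x).
    by do 2 (apply: bmB; last exact: bm_cst).
  have bLr : bounded_measurable (fun t => r t - \int[pibar]_t r t).
    by apply: bmB => //; exact: bm_cst.
  rewrite meanB; [|apply: bmB|exact: bmZ]; [|apply: bmD|]; first last.
  - exact: bmZ.
  - exact: bmZ.
  - exact: bm_cst.
  rewrite meanB; [|apply: bmD|exact: bmZ]; first last.
  - exact: bmZ.
  - exact: bm_cst.
  rewrite meanD; [|exact: bm_cst|exact: bmZ].
  rewrite mean_cst !meanZ// !meanBc//; last by apply: bmB => //; exact: bm_cst.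
  by rewrite -/x subrr mulr0 addr0.
rewrite -intk; apply: le_mean => //; first exact: (bm_mean1 bd).
move=> t.
pose j t' := G x + s * (L t - L t' - x) - gamma * (r t - r t') - lc * m t t'.
have bLt : bounded_measurable (fun t' => L t - L t' - x).
  by apply: bmB; [apply: bmB => //; exact: bm_cst|exact: bm_cst].
have brt : bounded_measurable (fun t' => r t - r t').
  by apply: bmB => //; exact: bm_cst.
have bA : bounded_measurable (fun t' => G x + s * (L t - L t' - x)).
  by apply: bmD; [exact: bm_cst|exact: bmZ].
have bB : bounded_measurable
    (fun t' => G x + s * (L t - L t' - x) - gamma * (r t - r t')).
  by apply: bmB => //; exact: bmZ.
have bj : bounded_measurable j by apply: bmB => //; exact: bmZ.
have -> : k t = \int[pibar]_t' j t'.
  rewrite meanB//; last exact: bmZ.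
  rewrite meanB//; last exact: bmZ.
  rewrite meanD//; [|exact: bm_cst|exact: bmZ].
  rewrite mean_cst !meanZ// meanBc ?mean_cB//.
  by apply: bmB => //; exact: bm_cst.
apply: le_mean => //; first exact: (bm_section1 bd).
move=> t'; rewrite /j /discrepancy 2!lerD2r.
by apply: log_loss_tangent => //; apply: tauL; [exact: diff_mean|exact: diffL].
Qed.

(** [KL rho mu <= K], in the dual form given by [donsker_varadhan]. In this form
    the case [rho = mu], [K = 0] is Jensen's inequality. *)
Definition entropy_bound (mu rho : probability T R) (K : R) : Prop :=
  forall u, bounded_measurable u -> \int[rho]_t u t - logZ mu u <= K.

(** The duality between entropy and exponential moments is used twice: once to
    change the first argument of the discrepancy from [pibar] to [rho], and once
    to bound the mean of [m] under [pibar] by an exponential moment under the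
    observable measure [gibbs_r l1]. The log-partition functions of [pibar] and
    [gibbs_r l1], the first of which is unknown, cancel in the sum. *)
Lemma pac_bayes (rho : probability T R) (l1 K : R) :
  entropy_bound (gibbs_r l1) rho K ->
  F N gamma beta (\int[rho]_t L t - \int[pibar]_t L t) <=
  K + (gamma - l1) * (\int[rho]_t r t - \int[pibar]_t r t)
    + log_moment N prior r m gamma l1 rho - ln c.
Proof.
move=> DV; have bd := bm_discrepancy.
pose h t := ln (\int[pibar]_t' expR (discrepancy t t')).
have be := bm_expR bd.
have Eh t : expR (h t) = \int[pibar]_t' expR (discrepancy t t').
  by rewrite lnK// posrE; apply: mean_expR_gt0; exact: (bm_section1 bd).
have bh : bounded_measurable h.
  have [_ [M hM]] := bd.
  apply: (bm_ln (c := expR (- M))); [exact: (bm_mean1 be)|exact: expR_gt0|].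
  move=> t; apply: mean_ge; first exact: (bm_section1 be).
  move=> t'; rewrite ler_expR lerNl; apply: le_trans (hM (t, t')).
  by rewrite -normrN ler_norm.
pose v t := l1 * r t - beta * L t.
have bv : bounded_measurable v by apply: bmB; exact: bmZ.
have bH : bounded_measurable (fun t => h t + v t) by exact: bmD.
(* [h + v] is the log-density of the tilted [pibar] with respect to
   [gibbs_r l1], up to a constant. *)
have := DV _ bH; rewrite logZ_gibbs// meanD// {1}/v meanB ?meanZ//; [|exact: bmZ..].
have -> : logZ prior (fun t => - l1 * r t + (h t + v t)) =
    logZ prior (fun t => - beta * L t + h t).
  by congr logZ; apply/funext => t; rewrite /v; ring.
have : logZ pibar h <= - ln c.
  rewrite -lnV ?posrE// /logZ; under eq_Rintegral do rewrite Eh.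
  by rewrite ler_ln ?posrE ?invr_gt0//; under eq_Rintegral do rewrite -Eh; exact: mean_expR_gt0.
rewrite logZ_gibbs// => hc DVh.
have hd : \int[rho]_t \int[pibar]_t' discrepancy t t' <= \int[rho]_t h t.
  apply: le_mean => //; first exact: (bm_mean1 bd).
  by move=> t; apply: jensen_expR; exact: (bm_section1 bd).
have := le_trans (mean_discrepancy rho) hd.
rewrite (mean_exchange (f := fun z => m z.1 z.2) bm)/=.
set Q := \int[pibar]_t' \int[rho]_t m t t'.
pose q t' := \int[rho]_t m t t'.
have bq : bounded_measurable q := bm_mean2 bm _.
have blq : bounded_measurable (fun t => lc * q t) by exact: bmZ.
have bw : bounded_measurable (fun t => lc * q t - v t) by exact: bmB.
have := gibbs_jensen prior bbL bw.
rewrite meanB// meanZ// {1}/v meanB ?meanZ//; [|exact: bmZ..].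
have -> : logZ prior (fun t => - beta * L t + (lc * q t - v t)) =
    logZ prior (fun t => - l1 * r t + lc * q t).
  by congr logZ; apply/funext => t; rewrite /v; ring.
have : log_moment N prior r m gamma l1 rho =
    logZ (gibbs_r l1) (fun t => lc * q t) by [].
rewrite logZ_gibbs// -/Q FE => ->; move: hc DVh.
do 4 move: (logZ _ _) => ?.
do ?move: (Rintegral _ _ _) => ?.
do 2 move: (ln _) => ?.
move: (log_loss _ _ _) => ?.
lra.
Qed.

Hypothesis beta0 : 0 < beta.
Hypothesis beta_lt : beta < N%:R * tau.
Hypothesis c1 : c <= 1.

Lemma log_moment_ge0 (rho : probability T R) l :
  0 <= log_moment N prior r m gamma l rho.
Proof.
have bq : bounded_measurable (fun t' => lc * \int[rho]_t m t t').
  by apply: bmZ; exact: (bm_mean2 bm).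
apply: le_trans (jensen_expR _ bq); apply: mean_ge => // t'.
rewrite mulr_ge0// ?mulr_ge0 ?ln_ge0 ?cosh_ge1//.
by apply: mean_ge => //; exact: (bm_section2 bm).
Qed.

(** Let [x] and [Dr] be the differences between the means under
    [rho = gibbs_r l2] and under [pibar] of [L] and of [r]. The sum of the two
    relative entropies between these measures is [J = beta * x - l2 * Dr >= 0].
    Then [pac_bayes] for [rho] bounds [G x], while [y = l2 * Dr / beta] is smaller
    than [x] by [J / beta]. As the slopes of [G] are at least [N * tau > beta],
    passing from [x] to [y >= 0] decreases [G] by at least [J], which is what is
    required to bound [F] at [y] whether or not [l2] exceeds [gamma]; a negative
    [y] is below any value of [Finv]. *)
Lemma gibbs_gap (l2 : R) :
  beta * gamma / N%:R * tau^-1 < l2 ->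
  \int[gibbs_r l2]_t r t - \int[pibar]_t r t <=
  beta / l2 * Finv N gamma (beta * gamma / l2)
    (log_moment N prior r m gamma l2 (gibbs_r l2) - ln c).
Proof.
move=> hl2; set rho : probability T R := gibbs_r l2.
have l20 : 0 < l2.
  by apply: le_lt_trans hl2; rewrite !mulr_ge0 ?invr_ge0// ltW.
have alpha_lt : beta * gamma / l2 < N%:R * tau.
  by move: hl2; rewrite !ltr_pdivrMr//; lra.
set Lp := (X in Finv _ _ _ X).
have Lp0 : 0 <= Lp by rewrite addr_ge0 ?log_moment_ge0// oppr_ge0 ln_le0.
set Dr := \int[rho]_t r t - \int[pibar]_t r t.
pose x := \int[rho]_t L t - \int[pibar]_t L t.
have main : F N gamma beta x <= 0 + (gamma - l2) * Dr + (Lp + ln c) - ln c.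
  have -> : Lp + ln c = log_moment N prior r m gamma l2 rho by rewrite subrK.
  by apply: pac_bayes => u bu; rewrite subr_le0; exact: jensen_expR.
have J0 : 0 <= beta * x - l2 * Dr.
  have bu : bounded_measurable (fun t => l2 * r t - beta * L t).
    by apply: bmB; exact: bmZ.
  have bu' : bounded_measurable (fun t => beta * L t - l2 * r t).
    by apply: bmB; exact: bmZ.
  have h1 := gibbs_jensen prior (blr l2) bu.
  have h2 := gibbs_jensen prior bbL bu'.
  have e1 : (fun t => - l2 * r t + (l2 * r t - beta * L t)) =
    (fun t => - beta * L t) by apply/funext => t; ring.
  have e2 : (fun t => - beta * L t + (beta * L t - l2 * r t)) =
    (fun t => - l2 * r t) by apply/funext => t; ring.
  rewrite {}e1 meanB ?meanZ// in h1; [|exact: bmZ..].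
  rewrite {}e2 meanB ?meanZ// in h2; [|exact: bmZ..].
  rewrite /x /Dr; move: h1 h2; rewrite -/rho.
  do 2 move: (logZ _ _) => ?.
  do 4 move: (Rintegral _ _ _) => ?.
  lra.
have [v0 v1] := Finv_spec hN gamma0 (beta * gamma / l2) Lp0.
have [y0|y0] := leP Dr 0.
  apply: le_trans y0 _; rewrite mulr_ge0//; first by rewrite divr_ge0// ltW.
  by case/andP : v0.
pose y := l2 * Dr / beta.
have DrE : Dr = beta / l2 * y by rewrite /y; field; rewrite !gt_eqF.
have yp : 0 < y by rewrite divr_gt0// mulr_gt0.
have yx : y <= x by rewrite ler_pdivrMr//; lra.
rewrite [leLHS]DrE ler_wpM2l//; first by rewrite divr_ge0// ltW.
have x1 := diff_mean rho pibar.
have by_ : beta * y = l2 * Dr by rewrite /y; field; rewrite gt_eqF.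
have ay : beta * gamma / l2 * y = gamma * Dr by rewrite DrE; field; rewrite gt_eqF.
apply: (le_Finv hN gamma0 alpha_lt) => //.
  apply: le_lt_trans (le_trans yx x1) _.
  by rewrite invf_gt1// tanh_lt1.
have yx' : 0 <= y <= x by rewrite (ltW yp).
rewrite FE ay; apply: (gibbs_gap_arith (x := x) (Gx := G x) (s := N%:R * tau) _ _ _ by_).
- by rewrite ler_wpM2r ?subr_ge0// ltW.
- exact: (log_loss_slope hN gamma0 yx' (tauL x1)).
- by move: main; rewrite FE add0r addrA addrK.
Qed.

End pac_bayes.

(** * Consequences for the empirical bound *)

Lemma le_bound_expr_arith (R : realType) (K g a b p lm lc B v : R) :
  g * (b - p) <= g * (B * v) ->
  K + g * (a - p) + lm - lc <= K + (g * (a - b) + lm - lc + g * B * v).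
Proof. lra. Qed.

Section empirical_bound.
Context d (T : measurableType d) (R : realType) (N : nat) (hN : (0 < N)%N).
Variables (prior : probability T R) (L r : T -> R) (m : T -> T -> R).
Hypotheses (bL : bounded_measurable L) (br : bounded_measurable r).
Hypothesis bm : bounded_measurable (fun z : T * T => m z.1 z.2).
Hypothesis L01 : forall t, 0 <= L t <= 1.
Hypothesis m0 : forall t t', 0 <= m t t'.
Variables (eps : R) (nu : probability R R).
Hypothesis heps : 0 < eps < 1.

Local Notation atom b := (fine (nu [set b])).
Local Notation pibar := (fun beta => gibbs prior (fun t => - beta * L t)).

Hypothesis exp_discrepancy : forall beta gamma, 0 < atom beta -> 0 < atom gamma ->
  \int[pibar beta]_t \int[pibar beta]_t' expR (discrepancy N L r m gamma t t')
  <= (eps * atom beta * atom gamma)^-1.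

Lemma atom_le1 (b : R) : atom b <= 1.
Proof.
rewrite -lee_fin fineK; last exact: fin_num_measure.
exact: probability_le1.
Qed.

(** The mean of [r] under the unknown [pibar], which remains in [pac_bayes], is
    eliminated by [gibbs_gap]. *)
Lemma le_bound_expr (rho : probability T R) beta gamma l1 l2 :
  0 < beta -> 0 < gamma -> 0 < atom beta -> 0 < atom gamma ->
  beta < N%:R * tanh (gamma / N%:R) ->
  0 <= l1 <= gamma -> beta * gamma / N%:R * (tanh (gamma / N%:R))^-1 < l2 ->
  ((F N gamma beta (\int[rho]_t L t - \int[pibar beta]_t L t))%:E <=
   bound_expr N prior eps nu r m rho beta gamma l1 l2)%E.
Proof.
move=> beta0 gamma0 ab ag beta_lt /andP[l10 l1g] hl2.
have /andP[e0 e1] := heps; set c := eps * atom beta * atom gamma.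
have c0 : 0 < c by rewrite !mulr_gt0.
have c1 : c <= 1.
  by rewrite /c !mulr_ile1 ?mulr_ge0 ?atom_le1// ltW.
have ed := exp_discrepancy ab ag.
have gap := gibbs_gap hN bL br bm L01 m0 gamma0 c0 ed beta0 beta_lt c1 hl2.
have bl1 : bounded_measurable (fun t => - l1 * r t) by exact: bmZ.
rewrite /bound_expr -/c.
have DV : forall u, bounded_measurable u -> ((\int[rho]_t u t -
    logZ (gibbs prior (fun t => (- l1 * r t)%R)) u)%:E <=
    KL rho (gibbs prior (fun t => (- l1 * r t)%R)))%E.
  by move=> u; exact: donsker_varadhan.
case: (KL _ _) DV => [K| |] DV.
- have DVK : entropy_bound (gibbs prior (fun t => - l1 * r t)) rho K.
    by move=> u /DV; rewrite lee_fin.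
  have main := pac_bayes hN bL br bm L01 gamma0 c0 ed DVK.
  rewrite -EFinD lee_fin; apply: le_trans main _.
  have gl1 : 0 <= gamma - l1 by rewrite subr_ge0.
  exact: le_bound_expr_arith (ler_wpM2l gl1 gap).
- by rewrite addye// leey.
- by have := DV _ (bm_cst T 0); rewrite leeNy_eq.
Qed.

(** The infimum of the bounds over [gamma] may be approached without being
    reached, whence a lower bound on [F] that does not depend on [gamma]. Since
    [F] increases with [tau > beta / N], its value for [tau = beta / N] is one,
    and it is positive because [ln (1 - u) < - u]. *)
Lemma F_gt_uniform beta x : 0 < beta -> 0 < x <= 1 ->
  exists2 e : R, 0 < e & forall gamma, 0 < gamma ->
    beta < N%:R * tanh (gamma / N%:R) -> e <= F N gamma beta x.
Proof.
move=> beta0 /andP[x0 x1].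
have N0 : 0 < N%:R :> R by rewrite ltr0n.
pose a := beta / N%:R.
have a0 : 0 < a by rewrite divr_gt0.
have [a1|a1] := ltP a 1; last first.
  exists 1 => // gamma g0 bt.
  have := tanh_lt1 (gamma / N%:R); rewrite ltNge => /negP[].
  by rewrite (le_trans a1)// ltW// ltr_pdivrMr// mulrC.
have ax : 0 < 1 - a * x.
  by rewrite subr_gt0; apply: le_lt_trans a1; rewrite ler_piMr// ltW.
exists (- N%:R * ln (1 - a * x) - beta * x).
  have : ln (1 - a * x) < - (a * x).
    rewrite -ltr_expR lnK ?posrE//; apply: expR_gt1Dx.
    by rewrite oppr_eq0 mulf_neq0// gt_eqF.
  rewrite -(ltr_pM2l N0) => h.
  have : N%:R * (a * x) = beta * x by rewrite /a; field; rewrite gt_eqF.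
  lra.
move=> gamma g0 bt; rewrite FE lerD2r /log_loss !mulNr lerN2 ler_pM2l//.
have ta : a < tanh (gamma / N%:R) by rewrite ltr_pdivrMr// mulrC.
have t1 := tanh_lt1 (gamma / N%:R).
rewrite ler_ln ?posrE//.
  by rewrite lerD2l lerN2 ler_pM2r// ltW.
rewrite subr_gt0; apply: le_lt_trans t1; rewrite ler_piMr//.
by rewrite (le_trans _ (ltW ta))// ltW.
Qed.

Lemma inf_bound_le0 (rho : probability T R) beta :
  (inf_bound N prior eps nu r m rho beta <= 0)%E ->
  0 < beta /\ \int[rho]_t L t <= \int[pibar beta]_t L t.
Proof.
move=> h.
have lt e : 0 < e -> exists gamma l1 l2, [/\ [/\ 0 < beta, 0 < gamma,
    0 < atom beta & 0 < atom gamma],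
    beta < N%:R * tanh (gamma / N%:R), 0 <= l1 <= gamma,
    beta * gamma / N%:R * (tanh (gamma / N%:R))^-1 < l2 &
    (bound_expr N prior eps nu r m rho beta gamma l1 l2 < e%:E)%E].
  move=> e0; have : (inf_bound N prior eps nu r m rho beta < e%:E)%E.
    by apply: le_lt_trans h _; rewrite lte_fin.
  move=> /ereal_inf_lt[_ [gamma /= bg <-]].
  rewrite /bound; case: ifPn => [/and4P[? ? ? ?]|_]; last by rewrite ltNge leey.
  by move=> /ereal_inf_lt[_ [l1 [l2 [? ? ->]]] ?]; exists gamma, l1, l2.
have [_ [_ [_ [[beta0 _ _ _] _ _ _ _]]]] := lt 1 ltr01.
split => //; rewrite leNgt; apply/negP; rewrite -subr_gt0 => x0.
have x1 : 0 < \int[rho]_t L t - \int[pibar beta]_t L t <= 1.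
  rewrite x0/=.
  have : \int[rho]_t L t <= 1 by apply: mean_le => // t; case/andP: (L01 t).
  have : 0 <= \int[pibar beta]_t L t by apply: mean_ge => // t; case/andP: (L01 t).
  lra.
have [e e0 he] := F_gt_uniform beta0 x1.
have [gamma [l1 [l2 [[_ g0 ab ag] bg hl1 hl2]]]] := lt e e0.
rewrite ltNge => /negP; apply.
apply: le_trans (le_bound_expr _ beta0 g0 ab ag bg hl1 hl2).
by rewrite lee_fin he.
Qed.

End empirical_bound.

(** * Gibbs means as functions of the inverse temperature *)

Section gibbs_mean.
Context d (T : measurableType d) (R : realType).
Variables (prior : probability T R) (L : T -> R).
Hypothesis bL : bounded_measurable L.
Hypothesis L01 : forall t, 0 <= L t <= 1.

Local Notation g := (fun b => \int[gibbs prior (fun t => - b * L t)]_t L t).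

Let bbL b : bounded_measurable (fun t => - b * L t). Proof. exact: bmZ. Qed.

(** Equality in Jensen's inequality forces [u] to be almost surely equal to its
    mean, as [expR x = 1 + x] only at [0]; the null sets are those of [prior],
    because the density of the Gibbs measure is positive. *)
Lemma gibbs_jensen_lt (h u h' : T -> R) : bounded_measurable h ->
  bounded_measurable u -> ~ (exists c, \forall t \ae prior, u t = c) ->
  (forall t, h' t = h t + u t) ->
  \int[gibbs prior h]_t u t < logZ prior h' - logZ prior h.
Proof.
move=> bh bu nu /funext ->; rewrite lt_neqAle gibbs_jensen// andbT.
apply/eqP => E; apply: nu; exists (\int[gibbs prior h]_t u t).
set c := \int[gibbs prior h]_t u t in E *.
pose f t := (expR (u t) - expR c * ((1 - c) + u t)).
have bl : bounded_measurable (fun t => expR c * ((1 - c) + u t)).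
  by apply/bmZ/bmD => //; exact: bm_cst.
have bf : bounded_measurable f by apply: bmB => //; exact: bm_expR.
have lt_f t : u t != c -> 0 < f t.
  move=> uc; rewrite subr_gt0 -[in ltRHS](subrKC c (u t)) [ltRHS]expRD.
  rewrite ltr_pM2l ?expR_gt0// -addrA [- c + _]addrC.
  by apply: expR_gt1Dx; rewrite subr_eq0.
have f0 t : 0 <= f t.
  have [uc|/lt_f/ltW//] := eqVneq (u t) c.
  by rewrite /f uc subrK mulr1 subrr.
have : \int[gibbs prior h]_t f t = 0.
  rewrite meanB//; last exact: bm_expR.
  rewrite meanZ; last by apply: bmD => //; exact: bm_cst.
  rewrite meanD//; last exact: bm_cst.
  rewrite mean_cst -/c subrK mulr1 -expR_logZ// logZ_gibbs// -E.
  by rewrite subrr.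
rewrite mean_gibbs// => /eqP; rewrite mulf_eq0 invr_eq0.
rewrite [X in _ || X]gt_eqF ?mean_expR_gt0// orbF => /eqP.
move=> /(mean_eq0 (bmM bf (bm_expR bh))) fe0.
have := fe0 (fun t => mulr_ge0 (f0 t) (expR_ge0 _)).
apply: filterS => t /eqP; rewrite mulf_eq0 expR_eq0 orbF => ft0.
apply/eqP; apply: contraTT ft0 => /lt_f f_gt0.
by rewrite gt_eqF.
Qed.

Hypothesis nconst : ~ (exists c, \forall t \ae prior, L t = c).

(** Both Jensen inequalities between the measures of parameters [b < b'] are
    strict; their sum is the claim. *)
Lemma gibbs_mean_lt b b' : b < b' -> g b' < g b.
Proof.
move=> bb'.
have nc k : k != 0 -> ~ (exists c, \forall t \ae prior, k * L t = c).
  move=> k0 [c hc]; apply: nconst; exists (k^-1 * c); apply: filterS hc => t <-.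
  by rewrite mulKf.
have d0 : 0 < b' - b by rewrite subr_gt0.
have h b1 b2 : b1 != b2 -> (b1 - b2) * g b1 <
    logZ prior (fun t => - b2 * L t) - logZ prior (fun t => - b1 * L t).
  move=> b12; rewrite -(meanZ _ _ bL); apply: gibbs_jensen_lt; first exact: bbL.
  - exact: bmZ.
  - by apply: nc; rewrite subr_eq0.
  - by move=> t; ring.
have h1 := h b b' (negbT (lt_eqF bb')).
have h2 := h b' b (negbT (gt_eqF bb')).
rewrite -(ltr_pM2l d0).
have := ltrD h1 h2; rewrite addrA subrK subrr -(opprB b' b) mulNr addrC subr_lt0.
exact.
Qed.

Lemma gibbs_mean_le b b' : b <= b' -> g b' <= g b.
Proof.
by rewrite le_eqVlt => /predU1P[->//|/gibbs_mean_lt/ltW].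
Qed.

Lemma gibbs_mean_ge0 b : 0 <= g b.
Proof. by apply: mean_ge => // t; case/andP: (L01 t). Qed.

Lemma gibbs_mean_le1 b : g b <= 1.
Proof. by apply: mean_le => // t; case/andP: (L01 t). Qed.

(** A quantitative form of continuity: on [[b, b']] the Gibbs weights change by
    a factor at most [expR (b' - b)]. *)
Lemma gibbs_mean_factor b b' : b <= b' -> g b <= expR (b' - b) * g b'.
Proof.
move=> bb'.
pose num b0 := \int[prior]_t (L t * expR (- b0 * L t)).
pose den b0 := \int[prior]_t expR (- b0 * L t).
have bN b0 : bounded_measurable (fun t => L t * expR (- b0 * L t)).
  by apply: bmM => //; exact/bm_expR/bbL.
have num0 b0 : 0 <= num b0.
  apply: mean_ge => // t.
  by rewrite mulr_ge0 ?expR_ge0//; case/andP: (L01 t).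
have den0 b0 : 0 < den b0 by exact/mean_expR_gt0/bbL.
have le_num : num b <= expR (b' - b) * num b'.
  rewrite /num -(meanZ _ _ (bN b')); apply: le_mean; [exact: bN|exact: bmZ|].
  move=> t; rewrite mulrCA -expRD; have /andP[t0 t1] := L01 t.
  rewrite ler_wpM2l// ler_expR.
  have : 0 <= (b' - b) * (1 - L t) by rewrite mulr_ge0// subr_ge0.
  move: (L t) => x; lra.
have le_den : den b' <= den b.
  apply: le_mean; [exact/bm_expR/bbL..|].
  move=> t; rewrite ler_expR !mulNr lerN2 ler_wpM2r//.
  by case/andP: (L01 t).
have le_ratio x y : x = num b / den b -> y = num b' / den b' ->
    x <= expR (b' - b) * y.
  move=> -> ->; rewrite mulrA; apply: ler_pM => //.
    by rewrite invr_ge0 ltW.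
  by rewrite lef_pV2 ?posrE.
exact: le_ratio (mean_gibbs prior (bbL b) bL) (mean_gibbs prior (bbL b') bL).
Qed.

Let cvg_pinfty : cvg (g b @[b --> +oo]).
Proof.
rewrite -is_cvgNE; apply/cvg_ex; eexists; apply: nondecreasing_cvgr.
  by move=> b b' bb' /=; rewrite lerN2; exact: gibbs_mean_le.
by exists 0 => _ [b _ <-] /=; rewrite oppr_le0; exact: gibbs_mean_ge0.
Qed.

Let cvg_ninfty : cvg (g b @[b --> -oo]).
Proof.
apply/cvg_ex; eexists; apply/cvgNy_compNP; apply: nondecreasing_cvgr.
  by move=> b b' bb' /=; apply: gibbs_mean_le; rewrite lerN2.
by exists 1 => _ [b _ <-] /=; exact: gibbs_mean_le1.
Qed.

Lemma le_gibbs_mean_pinfty (x : R) : (forall b, x <= g b) ->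
  x <= gibbs_mean prior L +oo%E.
Proof. by move=> xg; apply: limr_ge => //; apply: nearW => b; exact: xg. Qed.

Lemma gibbs_mean_pinfty_le b : gibbs_mean prior L +oo%E <= g b.
Proof.
apply: limr_le => //; near=> b'; apply: gibbs_mean_le; near: b'.
by apply: nbhs_pinfty_ge; exact: num_real.
Unshelve. all: by end_near. Qed.

Lemma gibbs_mean_ninfty_ge b : g b <= gibbs_mean prior L -oo%E.
Proof.
apply: limr_ge => //; near=> b'; apply: gibbs_mean_le; near: b'.
by apply: nbhs_ninfty_le; exact: num_real.
Unshelve. all: by end_near. Qed.

Lemma gibbs_mean_le_ninfty b : gibbs_mean prior L b <= gibbs_mean prior L -oo%E.
Proof.
case: b => [b| |//]; first exact: gibbs_mean_ninfty_ge.
exact: le_trans (gibbs_mean_pinfty_le 0) (gibbs_mean_ninfty_ge 0).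
Qed.

Lemma gibbs_mean_inj_le (b : \bar R) (b' : R) :
  gibbs_mean prior L b <= g b' -> (b'%:E <= b)%E.
Proof.
case: b => [b| |]; rewrite ?leey//; rewrite leNgt => h.
  by rewrite lee_fin leNgt; apply: contra h => /gibbs_mean_lt.
exfalso; move/negP: h; apply.
apply: lt_le_trans (gibbs_mean_ninfty_ge (b' - 1)).
by apply: gibbs_mean_lt; rewrite ltrBlDr ltrDl.
Qed.

(** The set of those [b] for which [x <= g b] is closed under suprema, even
    infinite ones, by monotonicity and continuity from the left. *)
Lemma le_gibbs_mean_sup (x : R) (S : set R) :
  (forall b, S b -> x <= g b) -> (-oo < ereal_sup (EFin @` S))%E ->
  x <= gibbs_mean prior L (ereal_sup (EFin @` S)).
Proof.
move=> xS; have ltS (c : R) : (c%:E < ereal_sup (EFin @` S))%E ->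
    exists2 b, S b & c < b.
  by move=> /ereal_sup_gt[_ [b Sb <-]]; rewrite lte_fin; exists b.
have leS b : S b -> (b%:E <= ereal_sup (EFin @` S))%E.
  by move=> Sb; apply: ereal_sup_ubound; exists b.
case: ereal_sup ltS leS => [s ltS leS _|ltS _ _|//].
  change (x <= g s); rewrite leNgt; apply/negP => gx.
  pose e := (x - g s) / 2.
  have e0 : 0 < e by rewrite divr_gt0// subr_gt0.
  have d0 : 0 < ln (1 + e) by rewrite ln_gt0// ltrDl.
  have [b Sb sb] : exists2 b, S b & s - ln (1 + e) < b.
    by apply: ltS; rewrite lte_fin ltrBlDr ltrDl.
  have bs : b <= s by rewrite -lee_fin; exact: leS.
  have h1 := le_trans (xS b Sb) (gibbs_mean_factor bs).
  have h2 : expR (s - b) <= 1 + e.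
    by rewrite -[leRHS]lnK ?posrE ?addr_gt0// ler_expR; lra.
  have h3 := le_trans h1 (ler_wpM2r (gibbs_mean_ge0 s) h2).
  have h4 : e * g s <= e by rewrite ler_piMr ?gibbs_mean_le1// ltW.
  have h5 : x - g s <= e by rewrite lerBlDl; apply: le_trans h3 _; rewrite mulrDl mul1r lerD2l.
  have E : 2 * e = x - g s by rewrite /e mulrC divfK.
  by move: h5; rewrite -E mulr_natl mulr2n gerDl leNgt e0.
apply: le_gibbs_mean_pinfty => b; have [b' Sb' bb'] := ltS b (ltry _).
exact: le_trans (xS _ Sb') (gibbs_mean_le (ltW bb')).
Qed.

End gibbs_mean.

Lemma ess_inf_lt_ess_sup_nconst d (T : measurableType d) (R : realType)
    (mu : probability T R) (f : T -> R) :
  (ess_inf mu (EFin \o f) < ess_sup mu (EFin \o f))%E ->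
  ~ (exists c, \forall t \ae mu, f t = c).
Proof.
move=> lt [c fc].
have mu0 : (0 < mu [set: T])%E by rewrite probability_setT.
have fc' : \forall t \ae mu, (EFin \o f) t = c%:E by apply: filterS fc => t /= ->.
by move: lt; rewrite (ess_inf_ae_cst _ mu0 fc') (ess_sup_ae_cst _ mu0 fc') ltxx.
Qed.

(** * Union bound over an atomic distribution *)

Section atomic_mixture.
Context d (T : measurableType d) (R : realType).
Variables (P : probability T R) (nu : probability R R).
Hypothesis nu_atomic : atomic nu.

(** A weighted form of the union bound: averaging the [U b] with the weights
    [nu [set b]] costs nothing in expectation, and every single [U b] is
    controlled by the average up to its weight. The countable support is
    enumerated injectively, as a family of sets with at most one element. *)
Lemma atomic_mixture (U : R -> T -> \bar R) :
  (forall b, measurable_fun [set: T] (U b)) ->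
  (forall b w, 0 <= U b w)%E ->
  (forall b, \int[P]_w U b w <= 1)%E ->
  exists W : T -> \bar R, [/\ measurable_fun [set: T] W,
    (forall w, 0 <= W w)%E, (\int[P]_w W w <= 1)%E &
    forall b w, (0 < nu [set b] -> nu [set b] * U b w <= W w)%E].
Proof.
move=> mU U0 U1; have [D /countable_injP[e einj] nuD] := nu_atomic.
pose a n : set R := D `&` e @^-1` [set n].
pose pt n : R := xget 0 (a n).
have aE n b : a n b -> a n = [set b].
  move=> [Db eb]; apply/seteqP; split => [b' [Db' eb']|b' ->//].
  by apply: einj; rewrite ?inE// eb eb'.
have ma n : measurable (a n).
  have [[b /aE ->]|/forallNP a0] := pselect (exists b, a n b).
    exact: measurable_set1.
  by rewrite (_ : a n = set0)// -subset0 => b /a0.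
have ta : trivIset [set: nat] a.
  apply/trivIsetP => i j _ _ ij; apply/seteqP; split => // b.
  by move=> [[_ /= ei] [_ /= ej]]; move: ij; rewrite -ei -ej eqxx.
have Da : \bigcup_n a n = D.
  by apply/seteqP; split => [b [n _ []]//|b Db]; exists (e b).
have mD : measurable D by rewrite -Da; exact: bigcup_measurable.
pose W w := (\sum_(0 <= n <oo) nu (a n) * U (pt n) w)%E.
have mterm n : measurable_fun [set: T] (fun w => nu (a n) * U (pt n) w)%E.
  exact: measurable_funeM.
have W0 n w : (0 <= nu (a n) * U (pt n) w)%E by rewrite mule_ge0.
exists W; split.
- by apply: (ge0_emeasurable_sum (P := xpredT)).
- by move=> w; apply: nneseries_ge0.
- rewrite integral_nneseries//.
  rewrite -nuD -Da measure_semi_bigcup//; last by rewrite Da.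
  apply: lee_nneseries => [n _ _|n _]; first exact: integral_ge0.
  rewrite ge0_integralZl//.
  by rewrite -[leRHS]mule1 lee_wpmul2l.
- move=> b w nub.
  have Db : D b.
    apply: contrapT => nDb; move: nub; rewrite (_ : nu [set b] = 0%E) ?ltxx//.
    apply: (subset_measure0 (B := ~` D)) => //; first exact: measurableC.
      by move=> _ ->.
    by have := probability_setC nu mD; rewrite nuD subee.
  have ab : a (e b) = [set b] by apply: aE.
  have ptb : pt (e b) = b.
    have : a (e b) (pt (e b)) by apply: xgetPex; exists b.
    by rewrite ab.
  apply: le_trans (nneseries_lim_ge (e b).+1 _); last by [].
  rewrite big_nat_recr//= ab ptb leeDr//.
  by apply: sume_ge0 => n _.
Qed.

End atomic_mixture.

(** Markov's inequality for the mixture over the two independent parameters. *)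
Lemma atomic_union_bound d (T : measurableType d) (R : realType)
    (P : probability T R) (nu : probability R R) (eps : R)
    (U : R -> R -> T -> R) :
  atomic nu -> 0 < eps -> (forall b c, bounded_measurable (U b c)) ->
  (forall b c w, 0 <= U b c w) -> (forall b c, \int[P]_w U b c w <= 1) ->
  exists E : set T, [/\ measurable E, ((1 - eps)%:E <= P E)%E &
    forall w, E w -> forall b c, 0 < fine (nu [set b]) ->
      0 < fine (nu [set c]) ->
      U b c w <= (eps * fine (nu [set b]) * fine (nu [set c]))^-1].
Proof.
move=> nu_atomic eps0 bU U0 U1.
have nufin b : nu [set b] \is a fin_num by exact: fin_num_measure.
have : forall b, exists W : T -> \bar R, [/\ measurable_fun [set: T] W,
    (forall w, 0 <= W w)%E, (\int[P]_w W w <= 1)%E &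
    forall c w, (0 < nu [set c] -> nu [set c] * (U b c w)%:E <= W w)%E].
  move=> b; apply: (atomic_mixture nu_atomic (U := fun c w => (U b c w)%:E)).
  - by move=> c; apply/measurable_EFinP; case: (bU b c).
  - by move=> c w; rewrite lee_fin.
  - by move=> c; rewrite mean_EFin// lee_fin.
move=> /choice[V hV].
have mV b : measurable_fun [set: T] (V b) by case: (hV b).
have V0 b : (forall w, 0 <= V b w)%E by case: (hV b).
have V1 b : (\int[P]_w V b w <= 1)%E by case: (hV b).
have [W [mW W0 W1 WV]] := atomic_mixture nu_atomic mV V0 V1.
pose E := [set w | W w < (eps^-1)%:E]%E.
have mE : measurable E.
  by rewrite -[E]setTI; exact: emeasurable_fun_infty_o.
exists E; split => //.
- have nE : (P (~` E) <= eps%:E)%E.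
    have -> : ~` E = [set: T] `&` [set w | ((eps^-1)%:E <= `|W w|)%E].
      rewrite setTI; apply/seteqP; split => w /=; rewrite gee0_abs//.
        by move/negP; rewrite -leNgt.
      by move=> h; apply/negP; rewrite -leNgt.
    have epsV0 : 0 < eps^-1 by rewrite invr_gt0.
    have := le_integral_abse P measurableT mW epsV0.
    under eq_integral do rewrite gee0_abs//.
    move=> /le_trans/(_ W1); rewrite -lee_pdivlMl// invrK mule1.
    exact.
  rewrite EFinB leeBlDr// -(probability_setT P) -(setUv E) measureU//; last 2 first.
    exact: measurableC.
    by rewrite setICr.
  by rewrite leeD2l.
- move=> w Ew b c nb nc.
  have [_ _ _ VU] := hV b.
  have nb' : (0 < nu [set b])%E by rewrite -(fineK (nufin b)) lte_fin.
  have nc' : (0 < nu [set c])%E by rewrite -(fineK (nufin c)) lte_fin.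
  have : (nu [set b] * (nu [set c] * (U b c w)%:E) <= (eps^-1)%:E)%E.
    apply: le_trans (ltW Ew); apply: le_trans (WV b w nb').
    by rewrite lee_wpmul2l// VU.
  rewrite -(fineK (nufin b)) -(fineK (nufin c)) -!EFinM lee_fin => h.
  rewrite -[leRHS]mul1r ler_pdivlMr ?mulr_gt0//.
  have := ler_wpM2l (ltW eps0) h; rewrite divff ?gt_eqF//; apply: le_trans.
  by rewrite le_eqVlt; apply/orP; left; apply/eqP; ring.
Qed.

(** * Exponential moments of the sample *)

Lemma indic_pred (T : Type) (R : realType) (b : pred T) (z : T) :
  \1_[set z | b z] z = (b z)%:R :> R.
Proof.
rewrite indicE; case: (boolP (b z)) => h; first by rewrite mem_set.
by rewrite memNset//; exact/negP.
Qed.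

Section product_moment.
Context d (T : measurableType d) (R : realType) (n : nat).
Variables (P_ : 'I_n -> probability T R) (P : probability (n.-tuple T) R).
Hypothesis hP : is_product_probability P_ P.

(** Expanding the product of sums turns independence of functions with finitely
    many values into independence of events. *)
Lemma mean_prod_indic (k : nat) (c : 'I_k -> R) (B : 'I_k -> set T) :
  (forall j, measurable (B j)) ->
  \int[P]_w \prod_(i < n) \sum_(j < k) c j * \1_(B j) (tnth w i) =
  \prod_(i < n) \sum_(j < k) c j * fine (P_ i (B j)).
Proof.
move=> mB.
have mC (s : {ffun 'I_n -> 'I_k}) :
    measurable [set w : n.-tuple T | forall i, B (s i) (tnth w i)].
  rewrite (_ : [set w | _] =
    \bigcap_(i in [set: 'I_n]) ((@tnth _ T ^~ i) @^-1` (B (s i)))).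
    apply: fin_bigcap_measurable => // i _; rewrite -[X in measurable X]setTI.
    exact: measurable_tnth.
  by apply/seteqP; split => [w h i _|w h i]; [exact: h|exact: (h i I)].
have E (w : n.-tuple T) : \prod_(i < n) \sum_(j < k) c j * \1_(B j) (tnth w i) =
    \sum_(s : {ffun 'I_n -> 'I_k}) (\prod_(i < n) c (s i)) *
      \1_[set w : n.-tuple T | forall i, B (s i) (tnth w i)] w :> R.
  rewrite bigA_distr_bigA; apply: eq_bigr => s _; rewrite big_split/=.
  congr (_ * _); rewrite indicE.
  have [h|h] := pselect (forall i, B (s i) (tnth w i)).
    rewrite mem_set// big1// => i _; rewrite indicE mem_set//; exact: h.
  rewrite memNset//; move/existsNP : h => [i hi].
  by rewrite (bigD1 i)//= indicE memNset// mul0r.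
under eq_Rintegral do rewrite E.
rewrite mean_sum; last by move=> s; apply/bmZ/bm_indic.
rewrite bigA_distr_bigA; apply: eq_bigr => s _.
rewrite meanZ; last exact: bm_indic.
have h := hP (fun i => mB (s i)).
by rewrite mean_indic// [X in fine X]h/= -big_split.
Qed.

Lemma mean_tnth_indic (A : set T) (i : 'I_n) : measurable A ->
  \int[P]_w \1_A (tnth w i) = fine (P_ i A).
Proof.
move=> mA.
have E : [set w : n.-tuple T | A (tnth w i)] =
    [set w | forall j, (if j == i then A else setT) (tnth w j)].
  apply/seteqP; split => [w Aw j|w /(_ i)]; last by rewrite eqxx.
  by case: eqP => [->|].
have mE : measurable [set w : n.-tuple T | A (tnth w i)].
  by rewrite -[X in measurable X]setTI; exact: measurable_tnth.
transitivity (\int[P]_w \1_[set w : n.-tuple T | A (tnth w i)] w).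
  apply: eq_Rintegral => w _; rewrite !indicE.
  by have [h|h] := pselect (A (tnth w i)); [rewrite !mem_set|rewrite !memNset].
have mA' j : measurable (if j == i then A else setT) by case: ifP.
rewrite mean_indic// E [X in fine X](hP mA').
rewrite (bigD1 i)//= eqxx big1 ?mulr1// => j /negbTE ->.
by rewrite probability_setT.
Qed.

End product_moment.

Section classification_moment.
Context dX dY dT (X : measurableType dX) (Y : measurableType dY)
  (Theta : measurableType dT) (R : realType) (N : nat) (hN : (0 < N)%N).
Hypotheses (finY : finite_set [set: Y]) (hY : forall A : set Y, measurable A).
Variables (P_ : 'I_N -> probability (X * Y)%type R).
Variables (P : probability (N.-tuple (X * Y)%type) R).
Hypothesis hP : is_product_probability P_ P.
Variable f : Theta -> X -> Y.
Hypothesis mf : measurable_fun [set: Theta * X] (fun z => f z.1 z.2).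

Local Notation Omega := (N.-tuple (X * Y)%type).
Local Notation L := (risk f P).

Let N0 : 0 < N%:R :> R. Proof. by rewrite ltr0n. Qed.

Lemma measurable_misclassified :
  measurable [set z : Theta * (X * Y) | f z.1 z.2.1 != z.2.2].
Proof.
pose g1 (z : Theta * (X * Y)) := f z.1 z.2.1.
pose g2 (z : Theta * (X * Y)) := z.2.2.
have mg1 : measurable_fun [set: Theta * (X * Y)] g1.
  apply: (measurableT_comp mf (g := fun z => (z.1, z.2.1))).
  apply: measurable_fun_pair; first exact: measurable_fst.
  by apply: (measurableT_comp measurable_fst); exact: measurable_snd.
have mg2 : measurable_fun [set: Theta * (X * Y)] g2.
  by apply: (measurableT_comp measurable_snd); exact: measurable_snd.
rewrite (_ : [set z | _] = ~` \bigcup_(y in [set: Y])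
    (g1 @^-1` [set y] `&` g2 @^-1` [set y])).
  apply: measurableC; apply: fin_bigcup_measurable => // y _.
  by apply: measurableI; rewrite -[X in measurable X]setTI;
    [exact: mg1|exact: mg2].
apply/seteqP; split => [z /eqP h [y _ [h1 h2]]|z h].
  by apply: h; rewrite -/(g1 z) h1 -h2.
by apply/eqP => E; apply: h; exists (g1 z) => //; split => //=; rewrite /g2 -E.
Qed.

Lemma bm_err (i : 'I_N) :
  bounded_measurable (fun z : Theta * Omega => err R f z.2 i z.1).
Proof.
have := bm_indic R measurable_misclassified.
have mg : measurable_fun [set: Theta * Omega] (fun z => (z.1, tnth z.2 i)).
  apply: measurable_fun_pair; first exact: measurable_fst.
  by apply: (measurableT_comp (measurable_tnth i)); exact: measurable_snd.
move=> /bm_comp/(_ mg); congr bounded_measurable; apply/funext => z.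
exact: (indic_pred _ (fun z : Theta * (X * Y) => f z.1 z.2.1 != z.2.2)).
Qed.

Let bm_errt (w : Omega) i : bounded_measurable (fun t => err R f w i t).
Proof. exact: (bm_section2 (bm_err i)). Qed.

Let bm_errw t i : bounded_measurable (fun w : Omega => err R f w i t).
Proof. exact: (bm_section1 (bm_err i)). Qed.

Let merr t : measurable [set z : X * Y | f t z.1 != z.2].
Proof.
rewrite (_ : [set z : X * Y | _] =
  (pair t) @^-1` [set z : Theta * (X * Y) | f z.1 z.2.1 != z.2.2])//.
rewrite -[X in measurable X]setTI.
by apply: pair1_measurable => //; exact: measurable_misclassified.
Qed.

Let errE (w : Omega) i t : err R f w i t = \1_[set z : X * Y | f t z.1 != z.2] (tnth w i).
Proof. by rewrite (indic_pred _ (fun z : X * Y => f t z.1 != z.2)). Qed.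

Definition err_prob (i : 'I_N) t : R := \int[P]_w err R f w i t.

Lemma riskE t : L t = N%:R^-1 * \sum_(i < N) err_prob i t.
Proof.
rewrite /risk; congr (_ * _); apply: eq_bigr => i _.
rewrite /err_prob; under eq_Rintegral do rewrite errE.
have mE : measurable [set w : Omega | f t (tnth w i).1 != (tnth w i).2].
  rewrite (_ : [set w | _] = (fun w : Omega => tnth w i) @^-1`
    [set z : X * Y | f t z.1 != z.2])//.
  by rewrite -[X in measurable X]setTI; exact: measurable_tnth.
by rewrite -mean_indic//; exact: eq_Rintegral.
Qed.

Lemma err_prob01 i t : 0 <= err_prob i t <= 1.
Proof.
by rewrite mean_ge ?mean_le// => w; rewrite /err; case: (_ != _).
Qed.

Lemma bm_risk : bounded_measurable L.
Proof.
rewrite (funext riskE); apply: bmZ; apply: bm_sum => i.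
exact: (bm_mean1 (bm_err i)).
Qed.

Let mean01 (a : 'I_N -> R) : (forall i, 0 <= a i <= 1) ->
  0 <= N%:R^-1 * \sum_(i < N) a i <= 1.
Proof.
move=> a01; apply/andP; split.
  by rewrite mulr_ge0 ?invr_ge0// sumr_ge0// => i _; case/andP: (a01 i).
rewrite mulrC ler_pdivrMr// mul1r.
apply: le_trans (ler_sum (G := fun=> 1) _ _) _.
  by move=> i _; case/andP: (a01 i).
by rewrite big_const_ord iter_addr addr0.
Qed.

Lemma risk01 t : 0 <= L t <= 1.
Proof. by rewrite riskE mean01// => i; exact: err_prob01. Qed.

Lemma bm_emp_risk (w : Omega) : bounded_measurable (emp_risk R f w).
Proof. by apply: bmZ; exact: bm_sum. Qed.

Let bm_diff (w : Omega) i : bounded_measurable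
  (fun z : Theta * Theta => err R f w i z.1 - err R f w i z.2).
Proof.
apply: bmB.
  by apply: (bm_comp (bm_errt w i)); exact: measurable_fst.
by apply: (bm_comp (bm_errt w i)); exact: measurable_snd.
Qed.

Lemma bm_emp_dist (w : Omega) :
  bounded_measurable (fun z : Theta * Theta => emp_dist R f w z.1 z.2).
Proof.
apply: bmZ; apply: bm_sum => i; have [mg [M hM]] := bm_diff w i.
split; first exact: measurableT_comp.
by exists M => z; rewrite normr_id.
Qed.

Lemma emp_dist_ge0 (w : Omega) t t' : 0 <= emp_dist R f w t t'.
Proof. by rewrite mulr_ge0 ?invr_ge0 ?sumr_ge0// ltW. Qed.

Section exponential_moment.
Variable gamma : R.
Local Notation tau := (tanh (gamma / N%:R)).

Let factor_gt0 x : `|x| <= 1 -> 0 < 1 - tau * x.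
Proof.
move=> x1; rewrite subr_gt0; apply: le_lt_trans (ler_norm _) _.
rewrite normrM; apply: le_lt_trans (norm_tanh_lt1 (gamma / N%:R)).
exact: ler_piMr.
Qed.

Let norm_diff (a b : R) : 0 <= a <= 1 -> 0 <= b <= 1 -> `|a - b| <= 1.
Proof.
by move=> /andP[? ?] /andP[? ?]; rewrite ler_norml; apply/andP; split; lra.
Qed.

(** For [x] in [{-1, 0, 1}], [1 - tanh a * x = expR (- a x) / cosh a ^ |x|]:
    this is what makes [emp_dist] appear with the coefficient [ln cosh]. *)
Lemma expR_discrepancy (w : Omega) t t' :
  expR (discrepancy N L (emp_risk R f w) (emp_dist R f w) gamma t t') =
  expR (log_loss N gamma (L t - L t')) *
  \prod_(i < N) (1 - tau * (err R f w i t - err R f w i t')).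
Proof.
set a := gamma / N%:R.
have -> : discrepancy N L (emp_risk R f w) (emp_dist R f w) gamma t t' =
    log_loss N gamma (L t - L t') + \sum_(i < N)
      (- a * (err R f w i t - err R f w i t')
       - ln (cosh a) * `|err R f w i t - err R f w i t'|).
  rewrite /discrepancy -/a -addrA -opprD; congr (_ + _).
  rewrite big_split/= -mulr_sumr sumrN -mulr_sumr sumrB mulNr -opprD.
  congr (- (_ + _)); rewrite /emp_risk /emp_dist.
    by rewrite -mulrBr mulrA.
  by rewrite mulrACA divff ?mul1r// gt_eqF.
rewrite expRD expR_sum; congr (_ * _); apply: eq_bigr => i _.
have c0 := cosh_gt0 a.
rewrite /err; case: (_ != _); case: (_ != _);
  rewrite ?subrr ?subr0 ?sub0r ?normrN ?normr1 ?normr0 ?mulr0 ?mulr1 ?subrr ?subr0 ?expR0//.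
- by rewrite expRB lnK ?posrE// -coshN expR_div_cosh tanhN.
- by rewrite mulrNN mulr1 expRB lnK ?posrE// expR_div_cosh mulrN1 opprK.
Qed.

(** By independence the mean is a product over the observations, which the
    inequality between arithmetic and geometric means compares with the [N]-th
    power for the averaged risks; the observations may thus have different
    distributions. *)
Lemma mean_expR_discrepancy t t' :
  \int[P]_w expR (discrepancy N L (emp_risk R f w) (emp_dist R f w) gamma t t')
  <= 1.
Proof.
under eq_Rintegral do rewrite expR_discrepancy.
have bfac (i : 'I_N) : bounded_measurable
    (fun w : Omega => 1 - tau * (err R f w i t - err R f w i t')).
  apply: bmB; first exact: bm_cst.
  by apply: bmZ; apply: bmB; exact: bm_errw.
rewrite meanZ; last by apply: bm_prod => i; exact: bfac.
(* Each factor is a combination of the indicators of the whole space and of the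
   misclassification events of [t] and [t']. *)
pose c (j : 'I_3) : R := [:: 1; - tau; tau]`_j.
pose B (j : 'I_3) : set (X * Y) :=
  nth setT [:: setT; [set z | f t z.1 != z.2]; [set z | f t' z.1 != z.2]] j.
have mB j : measurable (B j) by case: j => [[|[|[|//]]]] ?;
    [exact: measurableT|exact: merr|exact: merr].
have -> : \int[P]_w \prod_(i < N) (1 - tau * (err R f w i t - err R f w i t')) =
    \prod_(i < N) (1 - tau * (err_prob i t - err_prob i t')).
  transitivity (\int[P]_w \prod_(i < N) \sum_(j < 3) c j * \1_(B j) (tnth w i)).
    apply: eq_Rintegral => w _; apply: eq_bigr => i _.
    rewrite !big_ord_recl big_ord0/= /c /B/= -!errE indicE mem_set//.
    rewrite (_ : true%:R = 1)//; ring.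
  rewrite (mean_prod_indic hP _ mB); apply: eq_bigr => i _.
  rewrite !big_ord_recl big_ord0/= /c /B/= probability_setT.
  rewrite -!(mean_tnth_indic hP)//.
  rewrite /err_prob; under [in RHS]eq_Rintegral do rewrite errE.
  under [X in _ = 1 - tau * (_ - X)]eq_Rintegral do rewrite errE.
  rewrite /=; ring.
set x := L t - L t'.
have x1 : `|x| <= 1 by apply: norm_diff; exact: risk01.
have fx := factor_gt0 x1.
have -> : expR (log_loss N gamma x) = ((1 - tau * x) ^+ N)^-1.
  by rewrite /log_loss mulNr expRN mulrC expRM_natr lnK.
rewrite ler_pdivrMl ?exprn_gt0// mulr1.
pose E (i : 'I_N) := 1 - tau * (err_prob i t - err_prob i t').
have AGM : \prod_(i < N) E i <= ((\sum_(i < N) E i) / N%:R) ^+ N.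
  have := @leif_AGM _ _ (predT : {pred 'I_N}) E; rewrite /= cardT size_enum_ord.
  by case=> // i _; apply/ltW/factor_gt0/norm_diff; exact: err_prob01.
apply: le_trans AGM _; rewrite le_eqVlt; apply/orP; left; apply/eqP.
congr (_ ^+ _); rewrite /E sumrB -mulr_sumr sumrB.
rewrite big_const_ord iter_addr addr0 /x !riskE.
by field; rewrite gt_eqF.
Qed.

End exponential_moment.

End classification_moment.

(** * Gibbs moments and the effective temperature *)

Section gibbs_pair_moment.
Context dX dY dT (X : measurableType dX) (Y : measurableType dY)
  (Theta : measurableType dT) (R : realType) (N : nat) (hN : (0 < N)%N).
Hypotheses (finY : finite_set [set: Y]) (hY : forall A : set Y, measurable A).
Variables (P_ : 'I_N -> probability (X * Y)%type R).
Variables (P : probability (N.-tuple (X * Y)%type) R).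
Hypothesis hP : is_product_probability P_ P.
Variable f : Theta -> X -> Y.
Hypothesis mf : measurable_fun [set: Theta * X] (fun z => f z.1 z.2).

Local Notation Omega := (N.-tuple (X * Y)%type).
Local Notation disc gamma w := (discrepancy N (risk f P) (emp_risk R f w)
  (emp_dist R f w) gamma).

Lemma bm_expR_discrepancy gamma : bounded_measurable
  (fun z : (Omega * Theta) * Theta => expR (disc gamma z.1.1 z.1.2 z.2)).
Proof.
rewrite (_ : (fun z => _) = (fun z : (Omega * Theta) * Theta =>
    expR (log_loss N gamma (risk f P z.1.2 - risk f P z.2)) *
    \prod_(i < N) (1 - tanh (gamma / N%:R) *
      (err R f z.1.1 i z.1.2 - err R f z.1.1 i z.2)))); last first.
  by apply/funext => z; exact: expR_discrepancy.
have mw : measurable_fun [set: (Omega * Theta) * Theta] (fun z => z.1.1).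
  by apply: (measurableT_comp measurable_fst); exact: measurable_fst.
have mt : measurable_fun [set: (Omega * Theta) * Theta] (fun z => z.1.2).
  by apply: (measurableT_comp measurable_snd); exact: measurable_fst.
have bL := bm_risk finY hY P mf.
have t1 := norm_tanh_lt1 (gamma / N%:R).
apply: bmM; last first.
  apply: bm_prod => i; apply: bmB; first exact: bm_cst.
  apply: bmZ; apply: bmB.
    apply: (bm_comp (g := fun z : (Omega * Theta) * Theta => (z.1.2, z.1.1))
      (bm_err R finY hY mf i)).
    exact: measurable_fun_pair.
  apply: (bm_comp (g := fun z : (Omega * Theta) * Theta => (z.2, z.1.1))
    (bm_err R finY hY mf i)).
  by apply: measurable_fun_pair => //; exact: measurable_snd.
apply: bm_expR; apply: bmZ.
apply: (@bm_ln _ _ _ _ (1 - `|tanh (gamma / N%:R)|)).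
- apply: bmB; first exact: bm_cst.
  apply: bmZ; apply: bmB; first exact: (bm_comp bL mt).
  by apply: (bm_comp bL); exact: measurable_snd.
- by rewrite subr_gt0.
- move=> z; rewrite lerD2l lerN2; apply: le_trans (ler_norm _) _.
  rewrite normrM ler_piMr//.
  have /andP[? ?] := risk01 hN finY hY P mf z.1.2.
  have /andP[? ?] := risk01 hN finY hY P mf z.2.
  by rewrite ler_norml; apply/andP; split; lra.
Qed.

Variable mu : probability Theta R.

Lemma bm_pair_moment gamma : bounded_measurable
  (fun w : Omega => \int[mu]_t \int[mu]_t' expR (disc gamma w t t')).
Proof.
exact: (bm_mean1 (bm_mean1 (bm_expR_discrepancy gamma) mu) mu).
Qed.

Lemma mean_pair_moment gamma :
  \int[P]_w \int[mu]_t \int[mu]_t' expR (disc gamma w t t') <= 1.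
Proof.
have bK := bm_expR_discrepancy gamma.
have bK' := bm_mean1 bK mu.
rewrite (mean_exchange bK' P mu).
apply: mean_le; first exact: (bm_mean2 bK').
move=> t.
have mg : measurable_fun [set: Omega * Theta] (fun z => ((z.1, t), z.2)).
  apply: measurable_fun_pair; last exact: measurable_snd.
  by apply: measurable_fun_pair => //; exact: measurable_fst.
have bKt := bm_comp bK mg.
rewrite (mean_exchange bKt P mu).
apply: mean_le; first exact: (bm_mean2 bKt).
by move=> t'; exact: (mean_expR_discrepancy hN finY hY hP mf).
Qed.

End gibbs_pair_moment.

(** For a positive [c], the conventions on zero and infinite temperatures agree
    with the inverse of the extended reals: [t = 0] is below any [c^-1], and
    [b = 0] is excluded by [0 < c <= b]. *)
Lemma inverse_temperature_le (R : realType) (t b c : \bar R) :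
  inverse_temperature t b -> (0 < c)%E -> (c <= b)%E -> (t <= c^-1)%E.
Proof.
case: t => [r| |] /=.
- case: eqP => [-> _ c0 _|/eqP r0 -> c0 cb].
    by rewrite inve_ge0 ltW.
  have r_gt0 : 0 < r by rewrite -invr_gt0 -lte_fin; exact: lt_le_trans cb.
  have -> : (r%:E <= c^-1)%E = (c <= r%:E^-1)%E.
    by apply: inve_pge; apply: ltW; rewrite // lte_fin.
  by rewrite inver (negbTE r0).
- by move=> -> c0; rewrite leNgt c0.
- by rewrite leNye.
Qed.

Unset Implicit Arguments.

Theorem proposition1p40 (R : realType) (N : nat) (hN : (0 < N)%N)
  (dX dY dT : measure_display) (X : measurableType dX) (Y : measurableType dY)
  (Theta : measurableType dT)
  (hX : countably_generated X) (hTheta : countably_generated Theta)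
  (finY : finite_set [set: Y]) (hY : forall A : set Y, measurable A)
  (P_ : 'I_N -> probability (X * Y)%type R)
  (P : probability (N.-tuple (X * Y)%type) R)
  (hP : is_product_probability P_ P)
  (f : Theta -> X -> Y)
  (mf : measurable_fun [set: Theta * X] (fun z => f z.1 z.2))
  (prior : probability Theta R)
  (hprior : (ess_inf prior (EFin \o risk f P)
             < ess_sup prior (EFin \o risk f P))%E)
  (eps : R) (heps : 0 < eps < 1)
  (nu : probability R R) (nu_supp : nu `[0, +oo[%classic = 1%E) (nu_atomic : atomic nu) :
  exists E : set (N.-tuple (X * Y)%type),
    [/\ measurable E, ((1 - eps)%:E <= P E)%E &
      forall (rho : R.-pker (N.-tuple (X * Y)%type) ~> Theta) w, E w ->
        let bhat :=
          beta_hat N prior eps nu (emp_risk R f w) (emp_dist R f w) (kernel_at rho w) in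
        (forall t b, effective_temperature prior (risk f P) (kernel_at rho w) t b ->
           (bhat <= b)%E /\ ((-oo < bhat)%E -> (t <= bhat^-1)%E)) /\
        ((-oo < bhat)%E \/
           (exists t b, effective_temperature prior (risk f P) (kernel_at rho w) t b) ->
         \int[kernel_at rho w]_t risk f P t <= gibbs_mean prior (risk f P) bhat)].
Proof.
have bL := bm_risk finY hY P mf.
have L01 := risk01 hN finY hY P mf.
have nconst := ess_inf_lt_ess_sup_nconst hprior.
have eps0 : 0 < eps by case/andP: heps.
pose pibar b := gibbs prior (fun t => - b * risk f P t).
pose U b gamma (w : N.-tuple (X * Y)%type) := \int[pibar b]_t \int[pibar b]_t'
  expR (discrepancy N (risk f P) (emp_risk R f w) (emp_dist R f w) gamma t t').
have bU b gamma : bounded_measurable (U b gamma) by exact: bm_pair_moment.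
have U0 b gamma w : 0 <= U b gamma w.
  by apply: Rintegral_ge0 => t _; apply: Rintegral_ge0 => t' _; exact: expR_ge0.
have U1 b gamma : \int[P]_w U b gamma w <= 1.
  exact: (mean_pair_moment hN finY hY hP mf).
have [E [mE PE EU]] := atomic_union_bound nu_atomic eps0 bU U0 U1.
exists E; split => // rho w Ew /=.
set rhow := kernel_at rho w.
pose S := [set beta : R | (inf_bound N prior eps nu (emp_risk R f w)
  (emp_dist R f w) rhow beta <= 0)%E].
set bhat := beta_hat _ _ _ _ _ _ _.
have bhatE : bhat = ereal_sup (EFin @` S) by [].
have SP b : S b -> 0 < b /\ \int[rhow]_t risk f P t <= \int[pibar b]_t risk f P t.
  apply: (inf_bound_le0 hN bL (bm_emp_risk R finY hY mf w)
    (bm_emp_dist R finY hY mf w) L01 (emp_dist_ge0 R f w) heps).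
  by move=> b0 gamma; exact: EU.
have bhat_gt0 : (-oo < bhat)%E -> (0 < bhat)%E.
  rewrite bhatE => /ereal_sup_gt[_ [b Sb <-] _].
  apply: (@lt_le_trans _ _ b%:E); first by rewrite lte_fin; case: (SP b Sb).
  by apply: ereal_sup_ubound; exists b.
have le_b t b : effective_temperature prior (risk f P) rhow t b -> (bhat <= b)%E.
  move=> [_ rhoE]; rewrite bhatE; apply: ge_ereal_sup => _ [b' Sb' <-].
  apply: (gibbs_mean_inj_le bL L01 nconst); rewrite -rhoE.
  by case: (SP b' Sb').
split.
- move=> t b Tb; have bb := le_b t b Tb; split => // bhat0.
  exact: inverse_temperature_le Tb.1 (bhat_gt0 bhat0) bb.
- case=> [bhatNy|[t [b Tb]]].
    rewrite bhatE; apply: (le_gibbs_mean_sup bL L01 nconst) => [b /SP[]//|].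
    by rewrite -bhatE.
  have [bhatNy|] := boolP (-oo < bhat)%E.
    rewrite bhatE; apply: (le_gibbs_mean_sup bL L01 nconst) => [b' /SP[]//|].
    by rewrite -bhatE.
  rewrite ltNye negbK => /eqP ->; case: Tb => _ ->.
  exact: (gibbs_mean_le_ninfty bL L01 nconst).
Qed.
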